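(* Let $(G_\sigma)_{\sigma\ge1}$ be a log-convolution semi-group as in the context for which $\gamma(\sigma)=G_\sigma(\{1\})>0$, $\gamma$ is differentiable at $1$ and $\lim_{\lambda\downarrow0}\psi(\lambda)=0$. Let $X$ be the associated process described in the context. Then the infinitesimal generator of $X$ on the set of $C^2_0$-functions $f$ is given by $$A_0f(x)=\tfrac12 f''(x)$$ and, for $s>0$, $$A_sf(x)=\frac{x}{2s}f'(x)+\frac{-\gamma'(1)}{2s}\int_{\mathbb{R}}\big[f(x+z)-f(x)\big]\int_{[0,1)}\phi\big((\sqrt r-1)x,\;s(1-r),\;z\big)\,\bar G(dr)\,dz,$$ where $$\bar G(dr)=\lim_{\sigma\downarrow1}\frac{G_\sigma(dr\cap[0,1))}{G_\sigma([0,1))}$$ is a probability measure on $[0,1)$, the limit being understood in the weak sense.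
   Context: $\varepsilon_a$ is the Dirac measure at $a$; $\phi(\mu,v,\cdot)$ is the density of the Gaussian distribution with mean $\mu$ and variance $v$. A family $(G_\sigma)_{\sigma\ge1}$ of probability measures on $[0,1]$ is a log-convolution semi-group if, for all $\sigma,\tau\ge1$, the product of two independent random variables with distributions $G_\sigma$ and $G_\tau$ has distribution $G_{\sigma\tau}$. It has Laplace exponent $\psi(\lambda)=\beta\lambda+\int_0^\infty(1-e^{-\lambda x})\nu(dx)$ if, for $R_\sigma$ distributed as $G_\sigma$, $L_\sigma(\lambda):=\mathbb{E}[(R_\sigma)^\lambda]=\sigma^{-\psi(\lambda)}$ for all $\sigma\ge1$, $\lambda>0$, where $\beta\ge0$ and $\nu$ is a measure on $[0,\infty)$ with $\nu(\{0\})=0$ and $\int_0^\infty(1\wedge x)\nu(dx)<\infty$. Standing setting: $(G_\sigma)_{\sigma\ge1}$ is a log-convolution semi-group with Laplace exponent $\psi$ satisfying $\psi(1/2)=1$. $X$ is the Markov martingale with $X_0=0$ and transition probabilities: $P_{0,t}(x,dy)=\phi(x,t,y)\,dy$ for $t>0$, and for $0<s<t$, with $\sigma=\sqrt{t/s}$ and $\gamma(\sigma)=G_\sigma(\{1\})$, $$P_{s,t}(x,dy)=\gamma(\sigma)\,\varepsilon_{\sigma x}(dy)+\left(\int_{[0,1)}\phi\big(\sigma\sqrt r\,x,\;t(1-r),\;y\big)\,G_\sigma(dr)\right)dy.$$ The (time-inhomogeneous) infinitesimal generator is $A_sf(x)=\lim_{t\downarrow s}\frac{1}{t-s}\left(\int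 f(y)P_{s,t}(x,dy)-f(x)\right)$, i.e. $\lim_{t\downarrow s}\frac{1}{t-s}(\mathbb{E}[f(X_t)\mid X_s=x]-f(x))$, for each $x\in\mathbb{R}$. $C^2_0$-functions are twice continuously differentiable functions on $\mathbb{R}$ vanishing at infinity together with their first two derivatives. $\gamma'(1)$ is the (right) derivative of $\gamma:[1,\infty)\to(0,1]$ at $1$. *)

(* Defs.v *)
From HB Require Import structures.
From mathcomp Require Import all_boot all_order all_algebra.
From mathcomp Require Import all_classical all_reals all_analysis.
From mathcomp Require Import measurable_realfun.

Set Implicit Arguments.
Unset Strict Implicit.
Unset Printing Implicit Defensive.

Import Order.TTheory GRing.Theory Num.Theory.
Import numFieldNormedType.Exports.

Local Open Scope ring_scope.
Local Open Scope classical_set_scope.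

(* [normal_pdf] takes a standard deviation; [gauss_pdf] takes a variance. *)
Definition gauss_pdf {R : realType} (mu v y : R) : R :=
  normal_pdf mu (Num.sqrt v) y.

Definition independent_RV2 {R : realType} {d : measure_display}
    {T : measurableType d} (P : probability T R) (U V : {RV P >-> R}) : Prop :=
  forall A B : set R, measurable A -> measurable B ->
    P (U @^-1` A `&` V @^-1` B) = (P (U @^-1` A) * P (V @^-1` B))%E.

(* Families indexed by [1, +oo) are represented by functions on the whole of
   [R], about which nothing is assumed below 1; measures on an interval are
   Borel measures on [R] carried by that interval. *)
Record log_convolution_semigroup {R : realType} (G : R -> probability R R)
    : Prop := LogConvolutionSemigroup {
  lcs_carrier : forall sigma : R, 1 <= sigma -> G sigma `[0, 1] = 1%E ;
  lcs_mul : forall sigma tau : R, 1 <= sigma -> 1 <= tau ->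
    forall (d : measure_display) (T : measurableType d) (P : probability T R)
      (U V : {RV P >-> R}),
      independent_RV2 U V ->
      (forall A : set R, measurable A -> distribution P U A = G sigma A) ->
      (forall A : set R, measurable A -> distribution P V A = G tau A) ->
      forall A : set R, measurable A ->
        P ((fun w => U w * V w) @^-1` A) = G (sigma * tau) A }.

(* The integral defining [psi] is finite for [lambda > 0], since its integrand
   is at most [max 1 lambda * min 1 x]. *)
Definition has_laplace_exponent {R : realType} (G : R -> probability R R)
    (psi : R -> R) : Prop :=
  exists (beta : R) (nu : {measure set R -> \bar R}),
    [/\ 0 <= beta,
        nu `]-oo, 0[ = 0%E,
        nu [set 0] = 0%E &
        (\int[nu]_(x in `[0%R, +oo[) (Num.min 1 x)%:E < +oo)%E] /\
    (forall lambda : R, 0 < lambda ->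
      psi lambda = beta * lambda
        + \int[nu]_(x in `[0, +oo[) (1 - expR (- (lambda * x)))) /\
    (forall sigma lambda : R, 1 <= sigma -> 0 < lambda ->
      'E_(G sigma)[fun r : R => (r `^ lambda)%R]%E = (sigma `^ (- psi lambda))%:E).

Definition mass_at1 {R : realType} (G : R -> probability R R) (sigma : R) : R :=
  fine (G sigma [set 1]).

Definition right_derivable {R : realType} (g : R -> R) (a : R) : Prop :=
  cvg (h^-1 * (g (a + h) - g a) @[h --> 0^'+]).

Definition right_derivative {R : realType} (g : R -> R) (a : R) : R :=
  lim (h^-1 * (g (a + h) - g a) @[h --> 0^'+]).

Section transition.
Context {R : realType} (G : R -> probability R R) (s t x : R).
Local Open Scope ereal_scope.

Definition transition_density (y : R) : \bar R :=
  \int[G (Num.sqrt (t / s))]_(r in `[0%R, 1%R[)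
    (gauss_pdf (Num.sqrt (t / s) * Num.sqrt r * x) (t * (1 - r)) y)%:E.

(* The law P_(s,t)(x, .); meaningful for [0 <= s < t]. *)
Definition transition (B : set R) : \bar R :=
  if s == 0%R then \int[lebesgue_measure]_(y in B) (gauss_pdf x t y)%:E
  else (mass_at1 G (Num.sqrt (t / s)))%:E * \d_(Num.sqrt (t / s) * x)%R B
    + \int[lebesgue_measure]_(y in B) transition_density y.

Let transition_density_ge0 y : 0 <= transition_density y.
Proof.
by apply: integral_ge0 => r _; rewrite lee_fin; exact: normal_pdf_ge0.
Qed.

Let measurable_transition_density :
  measurable_fun [set: R] (transition_density : R -> \bar R).
Proof.
rewrite /transition_density; under eq_fun do rewrite integral_mkcond.
apply: (measurable_fun_fubini_tonelli_F
  (fun p : R * R => ((fun r => (gauss_pdf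
     (Num.sqrt (t / s) * Num.sqrt r * x) (t * (1 - r)) p.1)%:E)
       \_ `[0%R, 1%R[) p.2)).
- have sqrtT (u : R * R -> R) : measurable_fun setT u ->
      measurable_fun setT (fun p => Num.sqrt (u p)).
    move=> mu; apply: measurableT_comp mu.
    by apply: continuous_measurable_fun; exact: sqrt_continuous.
  have invT (u : R * R -> R) : (forall p, (0 <= u p)%R) ->
      measurable_fun setT u -> measurable_fun setT (fun p => ((u p)^-1)%R).
    move=> u0 mu; under eq_fun do rewrite -powR_inv1//.
    exact: (measurableT_comp (measurable_powR (-1)%R) mu).
  have msd : measurable_fun setT (fun p : R * R => Num.sqrt (t * (1 - p.2))).
    by apply: sqrtT; apply: measurable_funM => //; exact: measurable_funB.
  have msd2 : measurable_fun setT
      (fun p : R * R => (Num.sqrt (t * (1 - p.2)) ^+ 2)%R).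
    exact: measurable_funX.
  rewrite [X in measurable_fun _ X](_ : _ = (fun p : R * R => (gauss_pdf
     (Num.sqrt (t / s) * Num.sqrt p.2 * x) (t * (1 - p.2)) p.1)%:E)
     \_ (setT `*` `[0%R, 1%R[)); last first.
    by apply/funext => -[y r]; rewrite /= /patch /= in_setX in_setT.
  apply/(measurable_restrictT _ _).1; first exact: measurableX.
  apply/measurable_EFinP/measurable_funTS.
  rewrite /gauss_pdf /normal_pdf; apply: measurable_fun_ifT.
  + exact: measurable_fun_eqr.
  + by apply: (measurableT_comp (f := (\1_`[0%R, 1%R] : R -> R))) => //.
  + apply: measurable_funM.
      apply: invT => [p|]; first exact: sqrtr_ge0.
      apply: sqrtT; under eq_fun do rewrite -mulr_natr.
      by apply: measurable_funM => //; exact: measurable_funM.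
    rewrite /normal_fun; apply: measurableT_comp => //; apply: measurable_funM.
      apply: measurableT_comp => //; apply: measurable_funX.
      apply: measurable_funB => //; apply: measurable_funM => //.
      by apply: measurable_funM => //; exact: sqrtT.
    apply: invT => [p|]; first by rewrite mulrn_wge0// sqr_ge0.
    by under eq_fun do rewrite -mulr_natr; exact: measurable_funM.
- by move=> p; apply: erestrict_ge0 => r _; rewrite lee_fin; exact: normal_pdf_ge0.
Qed.

Let density_measure (g : R -> \bar R) : measurable_fun setT g ->
  (forall y, 0 <= g y) ->
  semi_sigma_additive (fun B => \int[lebesgue_measure]_(y in B) g y).
Proof.
move=> mg g0 A mA tA mUA; rewrite ge0_integral_bigcup//=; last first.
  exact: measurable_funTS.
by apply: is_cvg_ereal_nneg_natsum_cond => n _ _; exact: integral_ge0.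
Qed.

Let mass_at1_ge0 : 0 <= (mass_at1 G (Num.sqrt (t / s)))%:E.
Proof. by rewrite lee_fin fine_ge0. Qed.

Let transition0 : transition set0 = 0.
Proof.
rewrite /transition !integral_set0 measure0 mule0 adde0.
by case: ifP.
Qed.

Let transition_ge0 B : 0 <= transition B.
Proof.
rewrite /transition; case: ifP => _.
  by apply: integral_ge0 => y _; rewrite lee_fin; exact: normal_pdf_ge0.
by rewrite adde_ge0 ?mule_ge0//; exact: integral_ge0.
Qed.

Let transition_sigma_additive : semi_sigma_additive transition.
Proof.
rewrite /transition; have [_|_] := eqVneq s 0%R.
  apply: density_measure => [|y]; last by rewrite lee_fin; exact: normal_pdf_ge0.
  by apply/measurable_EFinP; exact: measurable_normal_pdf.
move=> A mA tA mUA.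
have Ed : (fun n => \sum_(0 <= i < n)
      ((mass_at1 G (Num.sqrt (t / s)))%:E * \d_(Num.sqrt (t / s) * x)%R (A i)
      + \int[lebesgue_measure]_(y in A i) transition_density y)) =
    (fun n => (mass_at1 G (Num.sqrt (t / s)))%:E
        * \sum_(0 <= i < n) \d_(Num.sqrt (t / s) * x)%R (A i)
      + \sum_(0 <= i < n) \int[lebesgue_measure]_(y in A i) transition_density y).
  by apply/funext => n; rewrite big_split/= ge0_sume_distrr.
rewrite Ed; apply: cvgeD; last exact: density_measure.
- rewrite ge0_adde_def ?inE ?mule_ge0//; exact: integral_ge0.
- apply: cvgeZl => //.
  exact: (@measure_semi_sigma_additive _ _ _ (\d_(Num.sqrt (t / s) * x)%R)).
Qed.

HB.instance Definition _ := isMeasure.Build _ _ _ transition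
  transition0 transition_ge0 transition_sigma_additive.

End transition.

Definition has_generator {R : realType} (G : R -> probability R R)
    (s : R) (f : R -> R) (x l : R) : Prop :=
  (t - s)^-1 * (\int[transition G s t x]_y f y - f x) @[t --> s^'+] --> l.

Definition past {R : realType} {d : measure_display} {T : measurableType d}
    {P : probability T R} (X : R -> {RV P >-> R}) (s : R) : set (set T) :=
  <<s [set A | exists u (B : set R),
         [/\ 0 <= u <= s, measurable B & A = X u @^-1` B]] >>.

Record associated_process {R : realType} {d : measure_display}
    {T : measurableType d} {P : probability T R} (G : R -> probability R R)
    (X : R -> {RV P >-> R}) : Prop := AssociatedProcess {
  ap_start : {ae P, forall w, X 0 w = 0} ;
  ap_markov : forall s t : R, 0 <= s -> s < t ->
    forall (A : set T) (B : set R), past X s A -> measurable B ->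
      P (A `&` X t @^-1` B) = (\int[P]_(w in A) transition G s t (X s w) B)%E ;
  ap_integrable : forall t : R, 0 <= t -> P.-integrable setT (EFin \o X t) ;
  ap_martingale : forall s t : R, 0 <= s -> s <= t ->
    forall A : set T, past X s A ->
      (\int[P]_(w in A) (X t w)%:E = \int[P]_(w in A) (X s w)%:E)%E }.

Definition vanishes_at_infinity {R : realType} (f : R -> R) : Prop :=
  f x @[x --> +oo] --> (0 : R) /\ f x @[x --> -oo] --> (0 : R).

Definition C20 {R : realType} (f : R -> R) : Prop :=
  [/\ forall x, derivable f x 1,
      forall x, derivable (f^`())%classic x 1 &
      continuous (f^`(2))%classic] /\
  [/\ vanishes_at_infinity f,
      vanishes_at_infinity (f^`())%classic &
      vanishes_at_infinity (f^`(2))%classic].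

(* The probability [G sigma] conditioned to [0, 1); [dirac 0] is used only
   where [G sigma] gives no mass to [0, 1). *)
Definition conditioned_below1 {R : realType} (G : R -> probability R R)
    (sigma : R) : probability R R :=
  mnormalize (mrestr (G sigma) (measurable_itv `[0%R, 1%R[%O)) (\d_(0 : R)).

Definition weak_limit_below1 {R : realType} (mu : R -> probability R R)
    (nu : probability R R) : Prop :=
  forall h : R -> R, {within `[0, 1[, continuous h} ->
    (exists M : R, forall r, 0 <= r < 1 -> `|h r| <= M) ->
    \int[mu sigma]_(r in `[0, 1[) h r @[sigma --> 1^'+]
      --> \int[nu]_(r in `[0, 1[) h r.

(* Main.v *)
(* Since gamma = G({1}) is positive, psi is bounded along the integers; hence the
   subordinator with Laplace exponent psi has no drift and a finite Levy measure
   nu, gamma(sigma) = sigma^(-c) with c = nu([0, +oo)) = psi(+oo), and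
   gamma'(1) = - c. The n-th moment of G_sigma conditioned to [0, 1), which is
   (sigma^(-psi n) - sigma^(-c)) / (1 - sigma^(-c)), tends to 1 - psi(n) / c as
   sigma decreases to 1, and this is the n-th moment of the image Gbar of nu / c
   under x |-> exp(-x). Convergence of moments gives weak convergence by
   Bernstein approximation; test functions need not extend continuously to 1,
   but Gbar puts no mass there.

   For the generator put T(a, b) = E f(a + b Z) with Z standard Gaussian. With
   sigma = sqrt(t / s),
     P_(s,t) f(x) - f(x) = gamma(sigma) (f(sigma x) - f(x))
       + (1 - gamma(sigma)) (\int T(sigma sqrt r x, sqrt(t (1 - r))) dG' - f(x)),
   where G' is G_sigma conditioned to [0, 1). After division by t - s the first
   term gives the drift x f'(x) / (2 s); in the second, the factor tends to
   c / (2 s), and since T is Lipschitz in (a, b) the weak convergence of G' gives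
   the jump integral. At s = 0 the claim is a second-order Taylor expansion. *)
Require Import Defs.
From HB Require Import structures.
From mathcomp Require Import all_boot all_order all_algebra.
From mathcomp Require Import all_classical all_reals all_analysis.
From mathcomp Require Import measurable_realfun ring lra.

Import Order.TTheory GRing.Theory Num.Theory.
Import numFieldNormedType.Exports.

Local Open Scope ring_scope.
Local Open Scope classical_set_scope.

(** * Integration *)

(** Conditioning on [0, 1) is meaningful because [psi 2^-1 = 1] forces c >= 1: the atom at 1
    contributes to E R^(1/2), so 2^(-c) = gamma(2) <= 2^(-1). The formula gamma(sigma) = sigma^(-c)
    is itself a limit of moments: on [0, 1) the powers r^n tend to 0, so the full n-th moment of
    G_sigma tends to the mass of its atom. The same vanishing controls test functions that oscillate
    near 1: multiplying by 1 - r^k costs at most M r^k, whose integral is again a moment, and small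
    under Gbar for large k. In the jump term the measure and the integrand both move with t. The
    Lipschitz bound on T is uniform in r, because E|Z|, sqrt r and sqrt (1 - r) are at most 1, so
    the integrand can be frozen at t = s before the weak limit is taken. The law [transition] is
    given by its values on sets. Integrals against it come from a density formula for nonnegative
    functions followed by Tonelli; bounded functions are made nonnegative by adding a constant. *)

Lemma cvg_nondecreasing_integral {d} {T : measurableType d} {R : realType}
    (m : {measure set T -> \bar R}) (D : set T) (g : (T -> \bar R)^nat)
    (f : T -> \bar R) : measurable D -> (forall n, measurable_fun D (g n)) ->
  (forall n x, D x -> (0 <= g n x)%E) ->
  (forall x, D x -> nondecreasing_seq (g ^~ x)) ->
  (forall x, D x -> g n x @[n --> \oo] --> f x) ->
  (\int[m]_(x in D) g n x @[n --> \oo] --> \int[m]_(x in D) f x)%E.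
Proof.
move=> mD mg g0 ndg gf.
have -> : (\int[m]_(x in D) f x = \int[m]_(x in D) limn (g ^~ x))%E.
  apply: eq_integral => x /set_mem Dx; apply/esym/cvg_lim; last exact: gf.
  by [].
exact: cvg_monotone_convergence.
Qed.

(** * Measures that are the sum of a given measure and a density *)

Section density.
Context {d} {T : measurableType d} {R : realType}.
Variables (rho m0 mu : {measure set T -> \bar R}) (g : T -> \bar R).
Hypotheses (mg : measurable_fun setT g) (g0 : forall x, (0 <= g x)%E).
Hypothesis rhoE : forall A, measurable A ->
  rho A = (m0 A + \int[mu]_(x in A) g x)%E.
Import HBNNSimple.
Local Open Scope ereal_scope.

(** The integral of a simple function is a finite sum over its values, and [rhoE] applies to each
    level set. *)
Lemma integral_density_nnsfun (h : {nnsfun T >-> R}) :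
  \int[rho]_x (h x)%:E = \int[m0]_x (h x)%:E + \int[mu]_x ((h x)%:E * g x).
Proof.
have mA y : measurable (h @^-1` [set y]) by exact: measurable_funPTI.
have hmu : \int[mu]_x ((h x)%:E * g x) =
    \sum_(y \in range h) y%:E * \int[mu]_(x in h @^-1` [set y]) g x.
  transitivity (\int[mu]_x (\sum_(y \in range h)
      (y * \1_(h @^-1` [set y]) x)%:E * g x)).
    apply: eq_integral => x _.
    rewrite -ge0_mule_fsuml => [|y]; last exact: nnfun_muleindic_ge0.
    by rewrite fsumEFin // -(fimfunE _ x).
  rewrite ge0_integral_fsum//; last 2 first.
    - by move=> y; apply: emeasurable_funM => //; apply/measurable_EFinP;
        apply: measurable_funM.
    - by move=> y x _; rewrite mule_ge0// nnfun_muleindic_ge0.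
  apply: eq_fsbigr => y; rewrite inE => -[t _ <-].
  under eq_integral do rewrite EFinM -muleA.
  rewrite ge0_integralZl//.
  - under eq_integral do rewrite muleC.
    rewrite (eq_integral (g \_ (h @^-1` [set h t]))); last first.
      by move=> x xE; rewrite epatch_indic.
    by rewrite -integral_mkcond.
  - by apply: emeasurable_funM => //; apply/measurable_EFinP.
  - by move=> x _; rewrite mule_ge0// lee_fin.
  - by rewrite lee_fin.
have hT : h \_ setT = h by apply/funext => x; rewrite patchT ?inE.
rewrite hmu !integral_nnsfun// hT !sintegralE.
have fr : finite_set (range h) by [].
rewrite -fsbig_split//=; apply: eq_fsbigr => y; rewrite inE => -[t _ <-].
by rewrite rhoE// ge0_muleDr//; apply: integral_ge0.
Qed.

(** Simple functions increase to [f], and monotone convergence passes to the limit in all three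
    integrals. The summand [m0] makes room for the atom of a transition law at [sigma * x]; it is
    [mzero] for a law with a density. *)
Lemma ge0_integral_density (f : T -> \bar R) : measurable_fun setT f ->
  (forall x, 0 <= f x) ->
  \int[rho]_x f x = \int[m0]_x f x + \int[mu]_x (f x * g x).
Proof.
move=> mf f0; pose h := nnsfun_approx measurableT mf.
have hf x : (h n x)%:E @[n --> \oo] --> f x.
  by apply: cvg_nnsfun_approx.
have hnd x : nondecreasing_seq (fun n => (h n x)%:E).
  by move=> a b ab; rewrite lee_fin; exact/lefP/nd_nnsfun_approx.
have hle n x : (h n x)%:E <= f x.
  have := @ereal_nondecreasing_cvgn _ _ (hnd x) => /(cvg_unique _ (hf x))-> //.
  by apply: ereal_sup_ubound; exists n.
have mh n : measurable_fun setT (fun x => (h n x)%:E) by exact/measurable_EFinP.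
have c (m : {measure set T -> \bar R}) : \int[m]_x (h n x)%:E @[n --> \oo] --> \int[m]_x f x.
  apply: (@cvg_nondecreasing_integral _ _ _ m setT (fun n x => (h n x)%:E) f)
    => [|n|n x _|x _|x _].
  - by [].
  - exact: mh.
  - by rewrite lee_fin.
  - exact: hnd.
  - exact: hf.
have cg : \int[mu]_x ((h n x)%:E * g x) @[n --> \oo] --> \int[mu]_x (f x * g x).
  apply: (@cvg_nondecreasing_integral _ _ _ mu setT
    (fun n x => (h n x)%:E * g x) (fun x => f x * g x)) => [|n|n x _|x _|x _].
  - by [].
  - exact: emeasurable_funM.
  - by rewrite mule_ge0// lee_fin.
  - by move=> a b ab; rewrite lee_wpmul2r//; exact: hnd.
  (* Multiplication by [g x = +oo] is discontinuous only at 0: if [f x = 0] every approximant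
     vanishes, and otherwise the approximants are eventually positive and the products are +oo. *)
  - have := g0 x; case gx: (g x) => [r| |] // _; first exact: cvgeZr.
    have := f0 x; rewrite le_eqVlt => /predU1P[fx|fx].
      rewrite -fx mul0e [X in X @ _ --> _](_ : _ = cst 0); first exact: cvg_cst.
      apply/funext => n /=; have := hle n x; rewrite -fx lee_fin => hn.
      by rewrite (_ : h n x = 0%R) ?mul0e//; apply/eqP; rewrite eq_le hn/=.
    rewrite gt0_muley//; apply: cvg_near_cst; have /= := hf x.
    move=> /(_ [set z | 0 < z]) H.
    have : \forall n \near \oo, 0 < (h n x)%:E.
      by apply: H; apply: open_nbhs_nbhs; split; first exact: open_ereal_gt_ereal.
    by apply: filterS => n hn; apply/eqP; rewrite gt0_muley.
have crho := c rho; apply: (cvg_unique _ crho) => //.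
rewrite (_ : (fun n => _) = (fun n => \int[m0]_x (h n x)%:E +
    \int[mu]_x ((h n x)%:E * g x))); last first.
  by apply/funext => n; exact: integral_density_nnsfun.
apply: cvgeD => //; rewrite ge0_adde_def// inE; apply: integral_ge0 => // x _.
exact: mule_ge0.
Qed.

End density.

Section integration.
Context {d} {T : measurableType d} {R : realType}.

Lemma bounded_integrable (m : {measure set T -> \bar R}) (D : set T)
    (f : T -> R) (M : R) : measurable D -> (m D < +oo)%E ->
  measurable_fun D f -> (forall x, D x -> `|f x| <= M) ->
  m.-integrable D (EFin \o f).
Proof.
move=> mD mDoo mf fM; apply: (@le_integrable _ _ _ m D mD _ (EFin \o cst M)).
- exact/measurable_EFinP.
- by move=> x Dx; rewrite /= lee_fin (le_trans (fM _ Dx))// ler_norm.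
- apply/integrableP; split; first exact/measurable_EFinP.
  by rewrite /= integral_cst// lte_mul_pinfty// lee_fin.
Qed.

Lemma Rintegral_bound (m : {measure set T -> \bar R}) (D : set T)
    (f g : T -> R) : measurable D ->
  m.-integrable D (EFin \o f) -> m.-integrable D (EFin \o g) ->
  (forall x, D x -> `|f x| <= g x) ->
  `|\int[m]_(x in D) f x| <= \int[m]_(x in D) g x.
Proof.
move=> mD mf mg fg; apply: le_trans (le_normr_Rintegral mD mf) _.
apply: le_Rintegral => //; exact: integrable_norm mf.
Qed.

Lemma cvg_Rintegral (m : {measure set T -> \bar R}) (D : set T)
    (f_ : nat -> T -> R) (f g : T -> R) : measurable D ->
  (forall n, measurable_fun D (f_ n)) ->
  (forall x, D x -> f_ n x @[n --> \oo] --> f x) ->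
  m.-integrable D (EFin \o g) ->
  (forall n x, D x -> `|f_ n x| <= g x) ->
  m.-integrable D (EFin \o f) /\
  \int[m]_(x in D) f_ n x @[n --> \oo] --> \int[m]_(x in D) f x.
Proof.
move=> mD mf_ cf ig fg.
have mf : measurable_fun D f by apply: measurable_fun_cvg mf_ cf.
have [] := @dominated_convergence _ _ _ m D mD (fun n => EFin \o f_ n) (EFin \o f)
  (EFin \o g).
- by move=> n; apply/measurable_EFinP.
- exact/measurable_EFinP.
- by apply: aeW => x Dx; apply: cvg_EFin; [exact: nearW|exact: cf].
- exact: ig.
- by apply: aeW => x n Dx; rewrite /= lee_fin fg.
move=> iF _ cF; split => //; apply: fine_cvg.
by rewrite fineK//; exact: integrable_fin_num.
Qed.

Section conditioned.
Variables (m : {measure set T -> \bar R}) (D : set T) (mD : measurable D).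
Variable P : probability T R.
Hypotheses (m0 : (0 < m D)%E) (moo : (m D < +oo)%E).
Local Notation mc := (mnormalize (mrestr m mD) P).

Lemma mnormalize_mrestrE A : mc A = (m (A `&` D) * ((fine (m D))^-1)%:E)%E.
Proof.
by rewrite /mnormalize/= /mrestr setTI gt_eqF// lt_eqF.
Qed.

(** The conditioned measure has the density [k * \1_D] with respect to [m]. *)
Lemma ge0_integral_mnormalize_mrestr (f : T -> \bar R) :
  measurable_fun setT f -> (forall x, 0 <= f x)%E ->
  (\int[mc]_x f x = ((fine (m D))^-1)%:E * \int[m]_(x in D) f x)%E.
Proof.
move=> mf f0; set k := (fine (m D))^-1.
have k0 : 0 <= k by rewrite invr_ge0 fine_ge0.
have mg : measurable_fun setT (fun x => (k * \1_D x)%:E).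
  by apply/measurable_EFinP; apply: measurable_funM.
rewrite (@ge0_integral_density _ _ _ mc mzero m (fun x => (k * \1_D x)%:E))//.
- rewrite integral_measure_zero add0e [in RHS]integral_mkcond -ge0_integralZl//.
  + apply: eq_integral => x _; rewrite EFinM muleCA; congr (_ * _)%E.
    by rewrite epatch_indic.
  + exact/(measurable_restrictT _ _).1/measurable_funTS.
  + by move=> x _; exact: erestrict_ge0.
- by move=> x; rewrite lee_fin mulr_ge0.
- move=> A mA; rewrite /mzero add0e.
  transitivity (m (A `&` D) * k%:E)%E; first exact: mnormalize_mrestrE.
  under eq_integral do rewrite EFinM.
  rewrite ge0_integralZl_EFin//; last exact/measurable_funTS/measurable_EFinP.
  by rewrite integral_indic// muleC setIC.
Qed.

Lemma Rintegral_mnormalize_mrestr (E : set T) (f : T -> R) (M : R) :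
  measurable E -> measurable_fun E f -> (forall x, E x -> `|f x| <= M) ->
  \int[mc]_(x in E) f x = (fine (m D))^-1 * \int[m]_(x in D `&` E) f x.
Proof.
move=> mE mf fM.
rewrite Rintegral_mkcond Rintegral_mkcondr; set g := f \_ E.
have mg : measurable_fun setT g by exact/(measurable_restrictT _ _).1.
have gM x : `|g x| <= `|M|.
  rewrite /g patchE; case: ifPn => [/set_mem Ex|_]; last by rewrite normr0.
  by rewrite (le_trans (fM _ Ex))// ler_norm.
have ig : m.-integrable D (EFin \o g).
  by apply: (@bounded_integrable _ _ _ `|M|) => //; exact: measurable_funTS.
rewrite /Rintegral integralE [in RHS]integralE.
rewrite !ge0_integral_mnormalize_mrestr//; last 2 first.
- by apply: measurable_funeneg; exact/measurable_EFinP.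
- by apply: measurable_funepos; exact/measurable_EFinP.
rewrite -muleBr//; last first.
  by apply: fin_num_adde_defr; exact: integrable_pos_fin_num ig.
rewrite fineM// fin_numB.
by rewrite (integrable_pos_fin_num mD ig) (integrable_neg_fin_num mD ig).
Qed.
End conditioned.

End integration.

(** * Gaussian integrals *)

Section gauss.
Context {R : realType}.
Notation mu := (@lebesgue_measure R).
Local Notation p := (@normal_pdf R 0 1).

Lemma normal_pdf_affine (a b z : R) : 0 < b ->
  normal_pdf a b (a + b * z) * b = normal_pdf 0 1 z.
Proof.
move=> b0; rewrite !normal_pdfE ?oner_neq0 ?gt_eqF// /normal_peak /normal_fun.
rewrite mulrAC; congr (_ * _); last first.
  congr expR; rewrite subr0 addrAC subrr add0r expr1n -(mulr_natr (b ^+ 2)) exprMn.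
  by field; rewrite gt_eqF.
rewrite expr1n mul1r -mulrnAr sqrtrM ?sqr_ge0// sqrtr_sqr gtr0_norm//.
by rewrite invfM mulrAC mulVf ?gt_eqF// mul1r.
Qed.

Lemma normal_pdf_opp (z : R) : p (- z) = p z.
Proof.
by rewrite !normal_pdfE ?oner_neq0// /normal_fun !subr0 sqrrN.
Qed.

Lemma derive_affine (a b : R) : (fun z : R => a + b * z)^`() = cst b.
Proof.
apply/funext => z; rewrite derive1E deriveD//.
by rewrite derive_cst add0r deriveM// derive_id derive_cst scaler0 addr0 /GRing.scale/= mulr1.
Qed.

Lemma integral_affine (a b : R) (G : R -> R) : 0 < b -> continuous G ->
  (forall y, 0 <= G y) ->
  (\int[mu]_y (G y)%:E = \int[mu]_z (G (a + b * z) * b)%:E)%E.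
Proof.
move=> b0 cG G0.
rewrite (@increasing_ge0_integration_by_substitutionT R (fun z => a + b * z))//.
- by rewrite derive_affine.
- by move=> x y xy; rewrite ltrD2l ltr_pM2l.
- by rewrite derive_affine => x; exact: cvg_cst.
- by rewrite derive_affine; exact: is_cvg_cst.
- by rewrite derive_affine; exact: is_cvg_cst.
- apply: (cvg_comp (fun z => b * z) (fun y => a + y)); last exact: cvg_addrl_Ny.
  exact: gt0_cvgMrNy.
- apply: (cvg_comp (fun z => b * z) (fun y => a + y)); last exact: cvg_addrl.
  exact: gt0_cvgMry.
Qed.

(** Both sides are split at 0 by [half] into integrals over the positive half-line; the reflection
    exchanges the two summands. *)
Lemma integralT_opp (G : R -> R) : continuous G -> (forall y, 0 <= G y) ->
  (\int[mu]_y (G (- y))%:E = \int[mu]_y (G y)%:E)%E.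
Proof.
move=> cG G0.
have half (H : R -> R) : continuous H -> (forall y, 0 <= H y) ->
    (\int[mu]_y (H y)%:E = \int[mu]_(y in `[0%R, +oo[) (H y)%:E +
      \int[mu]_(y in `[0%R, +oo[) (H (- y))%:E)%E.
  move=> cH H0; have mH : measurable_fun setT H by exact: continuous_measurable_fun.
  rewrite -(setUv `[0%R, +oo[%classic) ge0_integral_setU//=; last 4 first.
  - exact: measurableC.
  - by apply/measurable_EFinP; rewrite setUv.
  - by move=> x _; rewrite lee_fin.
  - exact/disj_setPCl.
  congr +%E; rewrite setCitvr integral_itv_bndo_bndc; last exact/measurable_EFinP/measurable_funTS.
  by rewrite -{1}oppr0 ge0_integration_by_substitutionNy//; exact: continuous_subspaceT.
rewrite half//; last first.
  by move=> y; apply: continuous_comp; [exact: continuousN|exact: cG].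
by rewrite [RHS]half// addeC; under eq_integral do rewrite opprK.
Qed.
End gauss.

Section gauss_moments.
Context {R : realType}.
Notation mu := (@lebesgue_measure R).
Local Notation p := (@normal_pdf R 0 1).
Local Notation N := (@normal_prob R 0 1).

Lemma ge0_integral_normal (f : R -> \bar R) : measurable_fun setT f ->
  (forall z, 0 <= f z)%E ->
  (\int[N]_z f z = \int[mu]_z (f z * (p z)%:E))%E.
Proof.
move=> mf f0.
rewrite (@ge0_integral_density _ _ _ N mzero mu (fun z => (p z)%:E))//.
- by rewrite integral_measure_zero add0e.
- by apply/measurable_EFinP; exact: measurable_normal_pdf.
- by move=> z; rewrite lee_fin normal_pdf_ge0.
- by move=> A mA; rewrite /mzero add0e.
Qed.

(** Substitution y = a + b z. From here on every Gaussian law is that of a + b Z with one fixed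
    standard Z, so that laws with different parameters can be compared pointwise in Z. *)
Lemma integral_normal_pdf_affine (f : R -> R) (a b : R) : 0 < b -> continuous f ->
  (forall y, 0 <= f y) ->
  (\int[mu]_y (f y * normal_pdf a b y)%:E = \int[N]_z (f (a + b * z))%:E)%E.
Proof.
move=> b0 cf f0; rewrite (@integral_affine _ a b)//; last 2 first.
- move=> y; apply: cvgM; first exact: cf.
  by apply: continuous_normal_pdf; rewrite gt_eqF.
- by move=> y; rewrite mulr_ge0// normal_pdf_ge0.
rewrite ge0_integral_normal; last 2 first.
- apply/measurable_EFinP; apply: continuous_measurable_fun => z.
  apply: continuous_comp; last exact: cf.
  by apply: cvgD; [exact: cvg_cst|apply: cvgM; [exact: cvg_cst|exact: cvg_id]].
- by move=> z; rewrite lee_fin.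
by apply: eq_integral => z _; rewrite -mulrA normal_pdf_affine// EFinM.
Qed.

Let pE (z : R) : p z = normal_peak 1 * expR (- (z ^+ 2 / 2)).
Proof. by rewrite normal_pdfE ?oner_neq0// /normal_fun subr0 expr1n mulNr. Qed.

Let continuous_p : continuous p.
Proof. by apply: continuous_normal_pdf; rewrite oner_neq0. Qed.

Lemma is_derive_normal_pdf (z : R) : is_derive z 1 p (- (z * p z)).
Proof.
rewrite pE (_ : p = fun z => normal_peak 1 * expR (- (z ^+ 2 / 2))); last first.
  by apply/funext => x; rewrite pE.
apply: is_derive_eq.
rewrite /GRing.scale/=; lra.
Qed.

(** By symmetry it is enough to compare half-lines. There x p(x) = - p'(x), and integration by parts
    on [0, n] turns the integral of x^2 p(x) into that of p(x), up to a boundary term - n p(n) that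
    tends to 0. *)
Lemma integral_normal_sqr : (\int[N]_z (z ^+ 2)%:E = 1)%E.
Proof.
have cx2p : continuous (fun z : R => z ^+ 2 * p z).
  by move=> z; apply: cvgM; [exact: exprn_continuous|exact: continuous_p].
rewrite ge0_integral_normal; last 2 first.
- by apply/measurable_EFinP; exact: measurable_funX.
- by move=> z; rewrite lee_fin sqr_ge0.
have itvE : [set x : R | 0 <= x] = `[0, +oo[%classic by rewrite -set_itvcy.
under eq_integral do rewrite -EFinM.
rewrite ge0_symfun_integralT//; last 2 first.
- by move=> z; rewrite mulr_ge0 ?sqr_ge0 ?normal_pdf_ge0.
- by move=> z /=; rewrite sqrrN normal_pdf_opp.
rewrite itvE.
have half : (2%:E * \int[mu]_(x in `[0%R, +oo[) (p x)%:E = 1)%E.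
  rewrite -itvE -(ge0_symfun_integralT (normal_pdf_ge0 0 1))//.
    exact: integral_normal_pdf.
  by move=> z /=; rewrite normal_pdf_opp.
rewrite -[RHS]half; congr (_ * _)%E.
have c1 := @ge0_cvgn_integral R mu _ (normal_pdf_ge0 0 1) (measurable_normal_pdf 0 1).
have c2 := @ge0_cvgn_integral R mu (fun z : R => z ^+ 2 * p z)
  (fun z => mulr_ge0 (sqr_ge0 z) (normal_pdf_ge0 0 1 z)) (continuous_measurable_fun cx2p).
apply: (cvg_unique _ c2) => //.
rewrite -(add0e (\int[mu]_(x in `[0%R, +oo[) (p x)%:E)%E).
have cvg_invn : (n%:R^-1 : R) @[n --> \oo] --> 0.
  apply/gtr0_cvgV0; last exact: cvgr_idn.
  by near=> n; rewrite ltr0n; near: n; exists 1%N.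
have pn : (- (n%:R * p n%:R))%:E @[n --> \oo] --> (0 : \bar R).
  apply: cvg_EFin; first exact: nearW.
  suff : n%:R * p n%:R @[n --> \oo] --> (0 : R) by move/cvgN; rewrite oppr0.
  (* The upper bound comes from exp(u) >= 1 + u at u = n^2 / 2, which gives n^2 <= 2 exp(n^2 /
     2). *)
  apply: (@squeeze_cvgr _ _ _ _ (cst 0) (fun n => normal_peak 1 * 2 * n%:R^-1)).
  - near=> n; suff: 0 <= n%:R * p n%:R <= normal_peak 1 * 2 * n%:R^-1 by [].
    apply/andP; split; first by rewrite mulr_ge0 ?normal_pdf_ge0.
    rewrite pE mulrCA -mulrA.
    rewrite ler_wpM2l ?normal_peak_ge0// expRN.
    have n0 : 0 < n%:R :> R by rewrite ltr0n; near: n; exists 1%N.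
    rewrite ler_pdivrMr ?expR_gt0// mulrAC ler_pdivlMr//.
    have := expR_ge1Dx ((n%:R : R) ^+ 2 / 2); lra.
  - exact: cvg_cst.
  - have : (normal_peak 1 * 2 * n%:R^-1 : R) @[n --> \oo] -->
        normal_peak 1 * 2 * (0 : R) by apply: cvgMl_tmp.
    by rewrite mulr0.
apply: cvg_trans (cvgeD _ pn c1); last by [].
apply: near_eq_cvg; near=> n.
have n0 : 0 < n%:R :> R by rewrite ltr0n; near: n; exists 1%N.
have -> : (\int[mu]_(x in `[0%R, n%:R]) (x ^+ 2 * p x)%:E =
   \int[mu]_(x in `[0%R, n%:R]) (x * - (- (x * p x)))%:E)%E.
  by apply: eq_integral => x _; rewrite opprK expr2 mulrA.
rewrite (@integration_by_parts R id (fun x => - p x) (cst 1) (fun x => - (- (x * p x))))//.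
- rewrite mul0r subr0 mulrN; congr (_ + _)%E.
  transitivity (- \int[mu]_(x in `[0%R, n%:R]) - (p x)%:E)%E.
    by rewrite integral_ge0N ?oppeK// => x _; rewrite lee_fin normal_pdf_ge0.
  by congr oppe; apply: eq_integral => x _; rewrite mul1r EFinN.
- by apply: continuous_subspaceT => x; exact: cvg_cst.
- split => //=; [exact: cvg_at_right_filter|exact: cvg_at_left_filter].
- by move=> x _; rewrite derive1E derive_id.
- apply: continuous_subspaceT => x; apply: cvgN; apply: cvgN; apply: cvgM; first exact: cvg_id.
  exact: continuous_p.
- split.
  + move=> x _; have h := is_derive_normal_pdf x; apply: derivableN.
    exact: ex_derive.
  + by apply: cvgN; apply: cvg_at_right_filter; exact: continuous_p.
  + by apply: cvgN; apply: cvg_at_left_filter; exact: continuous_p.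
- move=> x _; have h := is_derive_normal_pdf x.
  by rewrite derive1E derive_val.
Unshelve. all: by end_near. Qed.

End gauss_moments.

(** * Expectations of functions of a + b Z *)

Section gauss_mean.
Context {R : realType}.
Notation mu := (@lebesgue_measure R).
Local Notation N := (@normal_prob R 0 1).

Lemma normal_prob_lty (D : set R) : measurable D -> (N D < +oo)%E.
Proof. by move=> mD; rewrite (le_lt_trans (probability_le1 N mD))// ltry. Qed.

Lemma normal_prob_setT : N setT = 1%E.
Proof. exact: (@probability_setT _ _ _ N). Qed.

Lemma Rintegral_normal_cst (k : R) : \int[N]_z k = k.
Proof.
rewrite Rintegral_cst//; transitivity (k * fine 1%E); last by rewrite mulr1.
by congr (k * fine _); exact: normal_prob_setT.
Qed.

Lemma integrable_normal_sqr : N.-integrable setT (EFin \o (fun z => z ^+ 2)).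
Proof.
apply/integrableP; split; first by apply/measurable_EFinP; exact: measurable_funX.
under eq_integral do rewrite /= ger0_norm ?sqr_ge0//.
by rewrite integral_normal_sqr ltry.
Qed.

Lemma integrable_normal_cst (k : R) : N.-integrable setT (EFin \o cst k).
Proof.
by apply: (@bounded_integrable _ _ _ _ _ _ `|k|) => //; exact: normal_prob_lty.
Qed.

Lemma integrable_normal_id : N.-integrable setT (EFin \o id).
Proof.
have h := integrableD measurableT (integrable_normal_cst 1) integrable_normal_sqr.
apply: le_integrable h => //; first exact/measurable_EFinP.
move=> z _ /=; rewrite lee_fin [leRHS]ger0_norm ?addr_ge0 ?sqr_ge0//.
have : 0 <= (`|z| - 1) ^+ 2 by exact: sqr_ge0.
by have := real_normK (num_real z); have := normr_ge0 z; nra.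
Qed.

Lemma Rintegral_normal_sqr : \int[N]_z (z ^+ 2) = 1.
Proof. by rewrite /Rintegral integral_normal_sqr. Qed.

(** From |z| <= (1 + z^2) / 2. This is what gives [gauss_mean] the Lipschitz constant of [f] in its
    second parameter too. *)
Lemma Rintegral_normal_norm_le1 : \int[N]_z `|z| <= 1.
Proof.
have i1 : N.-integrable setT (EFin \o (fun z => 1 + z ^+ 2)).
  exact: (integrableD measurableT (integrable_normal_cst 1) integrable_normal_sqr).
apply: (@le_trans _ _ (\int[N]_z (2^-1 * (1 + z ^+ 2)))).
  apply: (@le_Rintegral _ _ _ N setT (fun z => `|z|) (fun z => 2^-1 * (1 + z ^+ 2))) => //.
  - exact: (integrable_norm integrable_normal_id).
  - exact: (integrableZl measurableT 2^-1 i1).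
  - move=> z _; have : 0 <= (`|z| - 1) ^+ 2 by exact: sqr_ge0.
    by have := real_normK (num_real z); have := normr_ge0 z; nra.
rewrite RintegralZl// RintegralD//; [|exact: integrable_normal_cst|exact: integrable_normal_sqr].
by rewrite Rintegral_normal_cst Rintegral_normal_sqr; lra.
Qed.

(** The identity is h(z) - h(-z) with h the positive part, and the two terms have equal integrals by
    symmetry of the density. The detour through h is due to [integralT_opp], which is about
    nonnegative functions. *)
Lemma Rintegral_normal_id : \int[N]_z z = 0.
Proof.
pose h (z : R) := Num.max z 0.
have ch : continuous h by move=> z; apply: continuous_max; [exact: cvg_id|exact: cvg_cst].
have h0 z : 0 <= h z by rewrite le_max lexx orbT.
have cp : continuous (@normal_pdf R 0 1) by apply: continuous_normal_pdf; rewrite oner_neq0.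
have chN : continuous (fun z : R => h (- z)).
  by move=> z; apply: continuous_comp; [exact: continuousN|exact: ch].
have mh : measurable_fun setT (fun z => (h z)%:E).
  by apply/measurable_EFinP; exact: continuous_measurable_fun.
have mhN : measurable_fun setT (fun z : R => (h (- z))%:E).
  by apply/measurable_EFinP; exact: continuous_measurable_fun.
have E : (\int[N]_z (h (- z))%:E = \int[N]_z (h z)%:E)%E.
  rewrite (ge0_integral_normal _ mhN) => [|z]; last by rewrite lee_fin.
  rewrite (ge0_integral_normal _ mh) => [|z]; last by rewrite lee_fin.
  rewrite [RHS](_ : _ = \int[mu]_z (h z * normal_pdf 0 1 z)%:E)%E//.
  rewrite -(@integralT_opp _ (fun z => h z * normal_pdf 0 1 z)).
  - by apply: eq_integral => z _; rewrite -EFinM normal_pdf_opp.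
  - by move=> z; apply: cvgM; [exact: ch|exact: cp].
  - by move=> z; rewrite mulr_ge0// normal_pdf_ge0.
have ih : N.-integrable setT (EFin \o h).
  apply: le_integrable integrable_normal_id => //.
  move=> z _ /=; rewrite lee_fin (ger0_norm (h0 z)) /h.
  by rewrite ge_max ler_norm normr_ge0.
have ihN : N.-integrable setT (EFin \o (fun z => h (- z))).
  apply: le_integrable integrable_normal_id => //.
  move=> z _ /=; rewrite lee_fin (ger0_norm (h0 _)) /h.
  by rewrite ge_max -normrN ler_norm normr_ge0.
have -> : \int[N]_z z = \int[N]_z (h z - h (- z)).
  apply: eq_Rintegral => z _; rewrite /h /Num.max oppr_lt0.
  by case: (ltgtP z 0) => [z0|z0|->]; rewrite ?subr0 ?sub0r ?opprK ?oppr0 ?subrr.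
by rewrite RintegralB// /Rintegral E subrr.
Qed.

(** This is the T(a, b) of the overview; [b] is a standard deviation, not a variance. *)
Definition gauss_mean (f : R -> R) (a b : R) : R := \int[N]_z f (a + b * z).

Let mf (f : R -> R) (a b : R) : continuous f -> measurable_fun setT (fun z => f (a + b * z)).
Proof.
move=> cf; apply: continuous_measurable_fun => z; apply: continuous_comp; last exact: cf.
by apply: cvgD; [exact: cvg_cst|apply: cvgM; [exact: cvg_cst|exact: cvg_id]].
Qed.

Section bounded.
Variables (f : R -> R) (M : R).
Hypotheses (cf : continuous f) (fM : forall x, `|f x| <= M).

Lemma integrable_gauss_mean a b : N.-integrable setT (EFin \o (fun z => f (a + b * z))).
Proof.
by apply: (@bounded_integrable _ _ _ _ _ _ M) => //; [exact: normal_prob_lty|exact: mf].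
Qed.

Lemma gauss_mean_le a b : `|gauss_mean f a b| <= M.
Proof.
have -> : M = \int[N]_z M by rewrite Rintegral_normal_cst.
apply: (@Rintegral_bound _ _ _ N) => //; first exact: integrable_gauss_mean.
exact: integrable_normal_cst.
Qed.

Lemma gauss_meanD a b k : gauss_mean (fun x => f x + k) a b = gauss_mean f a b + k.
Proof.
rewrite /gauss_mean RintegralD//; first by rewrite Rintegral_normal_cst.
- exact: integrable_gauss_mean.
- exact: integrable_normal_cst.
Qed.

(** The same Z drives both means, so the arguments of [f] differ by at most |a - a'| + |b - b'| |Z|,
    and E|Z| <= 1. *)
Lemma gauss_mean_lipschitz (L : R) a b a' b' : 0 <= L ->
  (forall x y, `|f x - f y| <= L * `|x - y|) ->
  `|gauss_mean f a b - gauss_mean f a' b'| <= L * (`|a - a'| + `|b - b'|).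
Proof.
move=> L0 fL; rewrite /gauss_mean -RintegralB//; [|exact: integrable_gauss_mean..].
have i1 : N.-integrable setT (EFin \o (fun z => L * `|a - a'| + L * `|b - b'| * `|z|)).
  exact: (integrableD measurableT (integrable_normal_cst _)
    (integrableZl measurableT _ (integrable_norm integrable_normal_id))).
apply: (@le_trans _ _ (\int[N]_z (L * `|a - a'| + L * `|b - b'| * `|z|))).
  apply: (@Rintegral_bound _ _ _ N setT (fun z => f (a + b * z) - f (a' + b' * z))) => //.
    exact: (integrableB measurableT (integrable_gauss_mean a b) (integrable_gauss_mean a' b')).
  move=> z _; rewrite (le_trans (fL _ _))// -mulrA -mulrDr ler_wpM2l//.
  rewrite (_ : _ - _ = (a - a') + (b - b') * z); last by ring.
  by rewrite (le_trans (ler_normD _ _))// normrM.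
rewrite RintegralD//; [|exact: integrable_normal_cst|
  exact: (integrableZl measurableT _ (integrable_norm integrable_normal_id))].
rewrite (@RintegralZl _ _ _ N setT (fun z => `|z|))//;
  last exact: (integrable_norm integrable_normal_id).
rewrite Rintegral_normal_cst mulrDr lerD2l ler_piMr ?mulr_ge0//.
exact: Rintegral_normal_norm_le1.
Qed.

Lemma integral_normal_pdf_gauss_mean a b : (forall x, 0 <= f x) -> 0 < b ->
  (\int[mu]_y (f y * normal_pdf a b y)%:E = (gauss_mean f a b)%:E)%E.
Proof.
move=> f0 b0; rewrite integral_normal_pdf_affine// /gauss_mean /Rintegral fineK//.
exact: (integrable_fin_num measurableT (integrable_gauss_mean a b)).
Qed.

End bounded.

End gauss_mean.

(** * Bernstein approximation and weak convergence *)

Section bernstein.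
Context {R : realType}.

(** The binomial law with parameters [n] and [x]; its mass, mean, second factorial moment and
    variance follow. *)
Definition bernstein_weight (n : nat) (x : R) (k : nat) : R :=
  'C(n, k)%:R * x ^+ k * (1 - x) ^+ (n - k).
Local Notation b := bernstein_weight.

Lemma sum_bernstein_weight n x : \sum_(k < n.+1) b n x k = 1.
Proof.
rewrite -[RHS](expr1n _ n) -[1 in RHS](subrK x) exprDn.
apply: eq_bigr => k _; rewrite /b mulr_natl mulrnAl; congr (_ *+ _).
by rewrite mulrC.
Qed.

(** The absorption identity k C(n, k) = n C(n - 1, k - 1) reduces the mean to the total mass for n -
    1; in the same way the next sum reduces to this one. *)
Lemma sum_bernstein_weight1 n x : \sum_(k < n.+1) k%:R * b n x k = n%:R * x.
Proof.
case: n => [|n]; first by rewrite big_ord1 !mul0r.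
transitivity (n.+1%:R * x * \sum_(k < n.+1) b n x k); last first.
  by rewrite sum_bernstein_weight mulr1.
rewrite big_ord_recl mul0r add0r.
rewrite mulr_sumr; apply: eq_bigr => k _; rewrite /b /= /bump /= add1n subSS.
have := mul_bin_diag n.+1 k => /(congr1 (fun m => m%:R : R)); rewrite !natrM => h.
rewrite !mulrA -h exprS; ring.
Qed.

Lemma sum_bernstein_weight2 n x :
  \sum_(k < n.+1) k%:R * (k%:R - 1) * b n x k = n%:R * (n%:R - 1) * x ^+ 2.
Proof.
case: n => [|n]; first by rewrite big_ord1 !mul0r.
rewrite big_ord_recl mul0r mul0r add0r.
transitivity (n.+1%:R * x * \sum_(k < n.+1) k%:R * b n x k).
  rewrite mulr_sumr; apply: eq_bigr => k _; rewrite /b /= /bump /= add1n subSS.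
  have := mul_bin_diag n.+1 k => /(congr1 (fun m => m%:R : R)); rewrite !natrM => h.
  rewrite exprS; transitivity
    (k.+1%:R * 'C(n.+1, k.+1)%:R *
      ((k.+1%:R - 1) * (x * x ^+ k) * (1 - x) ^+ (n - k))).
    ring.
  rewrite -h (_ : k.+1%:R - 1 = k%:R); last by rewrite -natr1 addrK.
  by rewrite /=; ring.
rewrite sum_bernstein_weight1 (_ : n.+1%:R - 1 = n%:R); last by rewrite -natr1 addrK.
by ring.
Qed.

Lemma bernstein_variance n x :
  \sum_(k < n.+1) (k%:R - n%:R * x) ^+ 2 * b n x k = n%:R * x * (1 - x).
Proof.
transitivity (\sum_(k < n.+1) (k%:R * (k%:R - 1) * b n x k +
   (1 - 2 * n%:R * x) * (k%:R * b n x k) + (n%:R * x) ^+ 2 * b n x k)).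
  by apply: eq_bigr => k _; ring.
rewrite 2!big_split/= -!mulr_sumr sum_bernstein_weight sum_bernstein_weight1
  sum_bernstein_weight2; ring.
Qed.

Lemma bernstein_weight_ge0 n x k : 0 <= x <= 1 -> 0 <= b n x k.
Proof.
by move=> /andP[x0 x1]; rewrite /b !mulr_ge0 ?exprn_ge0 ?subr_ge0.
Qed.

(** Heine-Cantor, from the near-covering form of compactness. Of the radius [r] given by continuity
    at a point, one half allows the centre to move and the other half bounds [del]. *)
Lemma itv_continuous_uniform (h : R -> R) : {within `[0, 1], continuous h} ->
  forall e : R, 0 < e -> exists2 del : R, 0 < del & forall x y : R, 0 <= x <= 1 -> 0 <= y <= 1 ->
    `|x - y| < del -> `|h x - h y| < e.
Proof.
move=> /subspace_continuousP ch e e0.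
have /compact_near_coveringP cov := @segment_compact R 0 1.
pose P del x := 0 <= x <= 1 -> forall y, 0 <= y <= 1 ->
  `|x - y| < del -> `|h x - h y| < e.
have /filter_ex[del [del0 hdel]] : \forall del \near (0 : R)^'+, 0 < del /\
    `[0%R, 1%R]%classic `<=` P del.
  apply: filterI; first exact: nbhs_right_gt.
  refine (cov R (at_right (0 : R)) P _ _) => x; rewrite /= in_itv/= => x01.
  have /cvgrPdist_lt /(_ (e / 2)) := ch x x01.
  rewrite divr_gt0// => /(_ isT); rewrite /within/= => /nbhs_ballP[r /= r0 hr].
  exists (ball x (r / 2), `]0, r / 2[%classic).
    split; first by apply: nbhsx_ballx; rewrite divr_gt0.
    near=> z; rewrite /= in_itv/=; apply/andP; split; near: z.
      exact: nbhs_right_gt.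
    by apply: nbhs_right_lt; rewrite divr_gt0.
  move=> [y del] /= [xy +] y01 z z01 yz; rewrite /= in_itv/= => /andP[del0 delr].
  have hy : `|h x - h y| < e / 2.
    by apply: hr => //; rewrite /ball/= in xy *; lra.
  have hz : `|h x - h z| < e / 2.
    apply: hr => //; rewrite /ball/= in xy *; rewrite -(subrK y x) -addrA.
    by rewrite (le_lt_trans (ler_normD _ _))//; lra.
  rewrite -(subrK (h x) (h y)) -addrA (le_lt_trans (ler_normD _ _))// distrC; lra.
by exists del => // x y x01; apply: hdel => //=; rewrite in_itv.
Unshelve. all: by end_near. Qed.

(** The Bernstein polynomial of [h], with Chebyshev's argument. Nodes k/n within [del] of [x]
    contribute at most e/2 by uniform continuity; at the others 2M is at most 2M (k - n x)^2 / (n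
    del)^2, which sums to a multiple of the variance n x (1 - x). *)
Lemma weierstrass_approximation (h : R -> R) : {within `[0, 1], continuous h} ->
  forall e : R, 0 < e -> exists q : {poly R}, forall x : R, 0 <= x <= 1 ->
    `|h x - q.[x]| <= e.
Proof.
move=> ch e e0.
have e20 : 0 < e / 2 by rewrite divr_gt0.
have [del d0 hd] := itv_continuous_uniform _ ch _ e20.
have [M M0 hM] : exists2 M : R, 0 <= M & forall x : R, 0 <= x <= 1 -> `|h x| <= M.
  have [M [Mr HM]] := compact_bounded (continuous_compact ch (@segment_compact R 0 1)).
  exists (`|M| + 1); first by rewrite addr_ge0.
  move=> x x01; apply: (HM (`|M| + 1)).
    by rewrite (le_lt_trans (ler_norm M))// ltrDl.
  by exists x => //=; rewrite in_itv.
(* Chosen so that 2M / (n del^2), the bound for the far nodes, is at most e/2. *)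
pose n := (Num.truncn (4 * M / (e * del ^+ 2))).+1.
have n0 : 0 < n%:R :> R by rewrite ltr0n.
pose q := \sum_(k < n.+1)
  ((h (k%:R / n%:R) * 'C(n, k)%:R)%:P * 'X^k * (1 - 'X) ^+ (n - k)) : {poly R}.
exists q => x x01.
have qE : q.[x] = \sum_(k < n.+1) h (k%:R / n%:R) * b n x k.
  rewrite /q horner_sum; apply: eq_bigr => k _.
  by rewrite !hornerM hornerC hornerXn horner_exp !hornerE.
have hxE : h x = \sum_(k < n.+1) h x * b n x k.
  by rewrite -mulr_sumr sum_bernstein_weight mulr1.
rewrite qE hxE -sumrB.
apply: le_trans (ler_norm_sum _ _ _) _.
have key (k : 'I_n.+1) : `|h x * b n x k - h (k%:R / n%:R) * b n x k| <=
    e / 2 * b n x k + 2 * M / (n%:R * del) ^+ 2 * ((k%:R - n%:R * x) ^+ 2 * b n x k).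
  have bk0 := bernstein_weight_ge0 n x k x01.
  have k01 : 0 <= (k%:R / n%:R : R) <= 1.
    by rewrite divr_ge0//= ler_pdivrMr// mul1r ler_nat -ltnS.
  rewrite -mulrBl normrM (ger0_norm bk0) [X in _ <= _ + X]mulrA -mulrDl ler_wpM2r//.
  have [xk|xk] := ltP `|x - k%:R / n%:R| del.
    apply: le_trans (ltW (hd _ _ x01 k01 xk)) _; rewrite lerDl.
    by rewrite mulr_ge0 ?sqr_ge0// divr_ge0 ?sqr_ge0// mulr_ge0.
  apply: (@le_trans _ _ (2 * M)).
    by rewrite (le_trans (ler_normB _ _))// mulr2n mulrDl !mul1r lerD// hM.
  rewrite -[leLHS]add0r; apply: lerD; first exact: ltW.
  rewrite -[leRHS]mulrA ler_peMr ?mulr_ge0//.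
  rewrite mulrC -expr_div_n -[leRHS]ger0_norm ?sqr_ge0// normrX exprn_ege1//.
  rewrite normrM normfV [X in _ / X]gtr0_norm ?mulr_gt0// ler_pdivlMr ?mulr_gt0// mul1r.
  rewrite distrC -(ler_pM2l n0) in xk; apply: le_trans xk _.
  rewrite -[X in X * _](gtr0_norm n0) -normrM mulrBr.
  by rewrite mulrCA divff ?mulr1// gt_eqF.
apply: le_trans; first by apply: ler_sum => k _; exact: key.
rewrite big_split/= -!mulr_sumr sum_bernstein_weight bernstein_variance mulr1.
have xx : x * (1 - x) <= 1.
  by case/andP: x01 => x0 x1; nra.
rewrite [leRHS](_ : e = e / 2 + e / 2); last by field.
rewrite lerD//.
have -> : 2 * M / (n%:R * del) ^+ 2 * (n%:R * x * (1 - x)) =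
    2 * M / (n%:R * del ^+ 2) * (x * (1 - x)).
  by field; rewrite !gt_eqF.
apply: (@le_trans _ _ (2 * M / (n%:R * del ^+ 2))).
  by rewrite ler_piMr// divr_ge0// mulr_ge0// sqr_ge0.
rewrite ler_pdivrMr ?mulr_gt0 ?exprn_gt0//.
have : 4 * M / (e * del ^+ 2) < n%:R by rewrite Num.Theory.truncnS_gt.
rewrite ltr_pdivrMr ?mulr_gt0 ?exprn_gt0//; lra.
Qed.

End bernstein.

(** * Moments on [0, 1) and weak convergence *)

Section moments.
Context {R : realType}.
Local Notation I01 := `[0%R, 1%R[%classic.

(** The point 1 is left out, so the moment of order 0 is the mass of [0, 1), and high moments tend
    to 0 even when [m] has an atom at 1. *)
Definition moment (m : probability R R) (n : nat) : R :=
  \int[m]_(r in `[0, 1[) r ^+ n.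

Lemma probability_lty (m : probability R R) (D : set R) : measurable D ->
  (m D < +oo)%E.
Proof. by move=> mD; rewrite (le_lt_trans (probability_le1 m mD))// ltry. Qed.

Lemma integrable_itv01 (m : probability R R) (f : R -> R) (M : R) :
  measurable_fun (I01 : set R) f -> (forall r : R, 0 <= r < 1 -> `|f r| <= M) ->
  m.-integrable I01 (EFin \o f).
Proof.
move=> mf fM; apply: (@bounded_integrable _ _ _ _ _ _ M) => //.
exact: probability_lty.
Qed.

Lemma integrable_moment (m : probability R R) n :
  m.-integrable I01 (EFin \o (fun r => r ^+ n)).
Proof.
apply: (@integrable_itv01 _ _ 1); first exact: measurable_funX.
move=> r /andP[r0 r1]; rewrite ger0_norm ?exprn_ge0// exprn_ile1//; exact: ltW.
Qed.

Lemma integrable_horner (m : probability R R) (q : {poly R}) :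
  m.-integrable I01 (EFin \o (fun r => q.[r])).
Proof.
have mq : measurable_fun setT (fun r => q.[r]).
  by apply: continuous_measurable_fun; exact: continuous_horner.
have [M [Mr HM]] := compact_bounded (continuous_compact
  (continuous_subspaceT (@continuous_horner R q)) (@segment_compact R 0 1)).
apply: (@integrable_itv01 _ _ (`|M| + 1)); first exact: measurable_funTS.
move=> r /andP[r0 r1]; apply: (HM (`|M| + 1)).
  by rewrite (le_lt_trans (ler_norm M))// ltrDl.
by exists r => //=; rewrite in_itv/= r0 ltW.
Qed.

Lemma Rintegral_horner (m : probability R R) (q : {poly R}) :
  \int[m]_(r in `[0, 1[) q.[r] = \sum_(i < size q) q`_i * moment m i.
Proof.
under eq_Rintegral do rewrite horner_coef.
elim: (size q) => [|n IH].
  rewrite big_ord0; under eq_Rintegral do rewrite big_ord0.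
  by rewrite Rintegral_cst// mul0r.
rewrite big_ord_recr/= -IH -RintegralZl//; last exact: integrable_moment.
rewrite -RintegralD//.
- by apply: eq_Rintegral => r _; rewrite big_ord_recr.
- have := integrable_horner m (\sum_(i < n) q`_i *: 'X^i).
  apply: eq_integrable => // r _; rewrite /= horner_sum; congr EFin.
  by apply: eq_bigr => i _; rewrite hornerZ hornerXn.
- have := integrable_horner m (q`_n *: 'X^n).
  by apply: eq_integrable => // r _; rewrite /= hornerZ hornerXn.
Qed.

(** Dominated convergence: r^n tends to 0 for r in [0, 1) and is bounded by 1. *)
Lemma moment_cvg0 (m : probability R R) : moment m n @[n --> \oo] --> 0.
Proof.
have [//|||||_] := @cvg_Rintegral _ _ _ m I01 (fun n r => r ^+ n) (cst 0) (cst 1).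
- by move=> n; exact: measurable_funX.
- move=> r; rewrite /= in_itv/= => /andP[r0 r1].
  by apply: cvg_expr; rewrite ger0_norm.
- by apply: (@integrable_itv01 _ _ 1) => // r _; rewrite /= normr1.
- move=> n r; rewrite /= in_itv/= => /andP[r0 r1].
  by rewrite ger0_norm ?exprn_ge0// exprn_ile1// ltW.
- by rewrite Rintegral_cst// mul0r.
Qed.

(* Multiplying by [1 - r ^+ k] makes [h] extend continuously to [0, 1]. *)
Lemma horner_approximation (h : R -> R) (M : R) (k : nat) :
  {within I01, continuous h} -> (forall r : R, 0 <= r < 1 -> `|h r| <= M) ->
  forall e : R, 0 < e -> exists q : {poly R}, forall r, 0 <= r < 1 ->
    `|h r - q.[r]| <= M * r ^+ k + e.
Proof.
move=> /subspace_continuousP ch hM e e0.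
pose hk r := if r < 1 then h r * (1 - r ^+ k) else 0.
have chk : {within `[0, 1], continuous hk}.
  apply/subspace_continuousP => x; rewrite /= in_itv/= => /andP[x0].
  have ck : {for x, continuous (fun r : R => 1 - r ^+ k)}.
    by apply: cvgB; [exact: cvg_cst|exact: exprn_continuous].
  rewrite le_eqVlt => /predU1P[x1|x1]; last first.
    have x01 : I01 x by rewrite /= in_itv/= x0.
    have /cvgrPdist_lt H : h r * (1 - r ^+ k) @[r --> within I01 (nbhs x)] -->
        h x * (1 - x ^+ k).
      apply: cvgM; first exact: ch.
      by apply: cvg_within_filter; exact: ck.
    apply/cvgrPdist_lt => eps eps0; have := H _ eps0; rewrite !near_withinE.
    move=> H'; near=> t => t01; suff: `|hk x - hk t| < eps by [].
    rewrite /hk x1.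
    have t1 : t < 1 by near: t; exact: lt_nbhsl.
    rewrite t1; have : I01 t by move: t01; rewrite /= !in_itv/= t1 => /andP[->].
    by near: t.
  (* At the point 1 nothing is known of the limit of [h]; its bound [M] against the factor 1 - r^k,
     which tends to 0, gives the continuity of [hk] there. *)
  move: x0 ck; rewrite {}x1 => _ ck.
  apply/cvgrPdist_lt => eps eps0; rewrite near_withinE.
  have M0 : 0 <= M by rewrite (le_trans _ (hM 0 _))// lexx ltr01.
  have : 1 - r ^+ k @[r --> (1 : R)] --> (1 - 1 ^+ k : R) by exact: ck.
  rewrite expr1n subrr => /cvgrPdist_lt.
  move=> /(_ (eps / (M + 1))); rewrite divr_gt0 ?ltr_wpDl// => /(_ isT) H.
  near=> t => t01; suff: `|hk 1 - hk t| < eps by [].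
  rewrite /hk ltxx; case: ifPn => t1; last by rewrite subrr normr0.
  rewrite sub0r normrN normrM.
  have ht : `|h t| <= M by apply: hM; move: t01; rewrite /= in_itv/= t1 => /andP[->].
  have : `|0 - (1 - t ^+ k)| < eps / (M + 1) by near: t.
  rewrite sub0r normrN ltr_pdivlMr ?ltr_wpDl//; apply: le_lt_trans.
  by rewrite mulrC ler_wpM2l// (le_trans ht)// lerDl.
have [q hq] := weierstrass_approximation _ chk _ e0.
exists q => r /andP[r0 r1].
have := hq r; rewrite r0 (ltW r1) /hk r1 => /(_ isT) h1.
have -> : h r - q.[r] = h r * r ^+ k + (h r * (1 - r ^+ k) - q.[r]) by ring.
rewrite (le_trans (ler_normD _ _))// lerD// normrM [X in _ * X]ger0_norm ?exprn_ge0//.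
by rewrite ler_wpM2r ?exprn_ge0// hM// r0.
Unshelve. all: by end_near. Qed.

(** Replacing [h] by a polynomial [q] changes its integral by at most M times the k-th moment plus
    e, under every law. The order [k] is fixed by making this small under [nu]; convergence of the
    k-th moment then makes it small under [mu s], and the integrals of [q] converge as linear
    combinations of moments. *)
Lemma moments_weak_limit (mu : R -> probability R R) (nu : probability R R) :
  (forall n, moment (mu s) n @[s --> 1^'+] --> moment nu n) ->
  weak_limit_below1 mu nu.
Proof.
move=> cm h ch [M hM].
have mh : measurable_fun (I01 : set R) h.
  exact: subspace_continuous_measurable_fun.
have M0 : 0 <= M by rewrite (le_trans _ (hM 0 _))// lexx ltr01.
have ih (m : probability R R) : m.-integrable I01 (EFin \o h).
  exact: integrable_itv01 mh hM.
(* Six shares: two for [h] against [q] under [nu], one for the integrals of [q], and three under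
   [mu s], where the k-th moment may itself be off by one share. *)
apply/cvgrPdist_le => eps eps0; pose e := eps / 6.
have e0 : 0 < e by rewrite divr_gt0.
have [k hk] : exists k, M * moment nu k <= e.
  have /cvgrPdist_le /(_ e e0) : M * moment nu n @[n --> \oo] --> M * 0.
    by apply: cvgMl_tmp; exact: moment_cvg0.
  move=> /filter_ex[k]; rewrite mulr0 sub0r normrN => Hk.
  by exists k; rewrite (le_trans (ler_norm _)).
have [q hq] := horner_approximation _ _ k ch hM _ e0.
have bnd (m : probability R R) :
    `|\int[m]_(r in `[0, 1[) h r - \int[m]_(r in `[0, 1[) q.[r]| <= M * moment m k + e.
  rewrite -RintegralB//; [|exact: ih|exact: integrable_horner].
  have ig : m.-integrable I01 (EFin \o (fun r => M * r ^+ k + e)).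
    apply: (@integrable_itv01 _ _ (M + e)).
      by apply: measurable_funD => //; apply: measurable_funM.
    move=> r /andP[r0 r1]; rewrite ger0_norm; last first.
      by rewrite addr_ge0 ?(ltW e0)// mulr_ge0// exprn_ge0.
    by rewrite lerD2r ler_piMr// exprn_ile1// ltW.
  apply: (@le_trans _ _ (\int[m]_(r in `[0, 1[) (M * r ^+ k + e))).
    apply: (@Rintegral_bound _ _ _ m I01 (fun r => h r - q.[r])) => //.
    - exact: (integrableB (measurable_itv _) (ih m) (integrable_horner m q)).
  rewrite RintegralD//; last 2 first.
  - exact: (integrableZl (measurable_itv _) M (integrable_moment m k)).
  - by apply: (@integrable_itv01 _ _ e) => // r _; rewrite /= ger0_norm// ltW.
  rewrite RintegralZl//; last exact: integrable_moment.
  rewrite lerD2l Rintegral_cst// ler_piMr ?(ltW e0)//.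
  rewrite -lee_fin fineK ?fin_num_measure//; exact: probability_le1.
have cq : \int[mu s]_(r in `[0, 1[) q.[r] @[s --> 1^'+] -->
    \int[nu]_(r in `[0, 1[) q.[r].
  rewrite Rintegral_horner; under eq_fun do rewrite Rintegral_horner.
  apply: cvg_big => [|i _]; first exact: add_continuous.
  by apply: cvgMl_tmp; exact: cm.
have ck : M * moment (mu s) k @[s --> 1^'+] --> M * moment nu k.
  by apply: cvgMl_tmp; exact: cm.
near=> s.
have h1 : `|\int[nu]_(r in `[0, 1[) q.[r] - \int[mu s]_(r in `[0, 1[) q.[r]| <= e.
  by near: s; move: cq => /cvgrPdist_le; exact.
have h2 : `|M * moment nu k - M * moment (mu s) k| <= e.
  by near: s; move: ck => /cvgrPdist_le; exact.
have := bnd nu; have := bnd (mu s).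
have e6 : eps = 6 * e by rewrite /e; field.
move: h1 h2; rewrite !ler_norml e6 => /andP[h11 h12] /andP[h21 h22].
move=> /andP[h31 h32] /andP[h41 h42]; apply/andP; split; lra.
Unshelve. all: by end_near. Qed.

End moments.

(** * Transition kernels *)

Section mixture.
Context {R : realType}.
Notation mu := (@lebesgue_measure R).
Local Notation I01 := (`[0%R, 1%R[%classic : set R).

Lemma measurable_normal_pdf_comp {d} {T : measurableType d} (u w y : T -> R) :
  measurable_fun setT u -> measurable_fun setT w -> measurable_fun setT y ->
  measurable_fun setT (fun p => normal_pdf (u p) (w p) (y p)).
Proof.
move=> mea mw my; rewrite /normal_pdf.
have invT (h : T -> R) : (forall p, 0 <= h p) ->
    measurable_fun setT h -> measurable_fun setT (fun p => (h p)^-1).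
  move=> h0 mh; under eq_fun do rewrite -powR_inv1//.
  exact: (measurableT_comp (measurable_powR (-1)) mh).
have mw2 : measurable_fun setT (fun p => w p ^+ 2) by exact: measurable_funX.
apply: measurable_fun_ifT.
- exact: measurable_fun_eqr.
- exact: (measurableT_comp (f := (\1_`[0%R, 1%R] : R -> R))).
- apply: measurable_funM.
    apply: invT => [p|]; first exact: sqrtr_ge0.
    apply: measurableT_comp; first exact: (continuous_measurable_fun (@sqrt_continuous R)).
    by under eq_fun do rewrite -mulr_natr; do 2 apply: measurable_funM => //.
  rewrite /normal_fun; apply: measurableT_comp => //; apply: measurable_funM.
    by apply: measurableT_comp => //; apply: measurable_funX; exact: measurable_funB.
  apply: invT => [p|]; first by rewrite mulrn_wge0// sqr_ge0.
  by under eq_fun do rewrite -mulr_natr; exact: measurable_funM.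
Qed.

Lemma integral_indicM (m : {measure set R -> \bar R}) (D : set R) (g : R -> R) :
  (\int[m]_(r in D) (g r)%:E = \int[m]_r (\1_D r * g r)%:E)%E.
Proof.
rewrite integral_mkcond; apply: eq_integral => r _.
by rewrite patchE indicE; case: ifPn => _; rewrite ?mul1r ?mul0r.
Qed.

Section fixed_mixture.
Variables (m : probability R R) (a : R -> R) (v : R).
Hypotheses (ma : measurable_fun setT a) (v0 : 0 < v).
Local Notation q y := (\int[m]_(r in I01) (gauss_pdf (a r) (v * (1 - r)) y)%:E)%E.

Let mpdf : measurable_fun setT (fun p : R * R => gauss_pdf (a p.2) (v * (1 - p.2)) p.1).
Proof.
apply: measurable_normal_pdf_comp => //; first exact: measurableT_comp.
apply: measurableT_comp; first exact: (continuous_measurable_fun (@sqrt_continuous R)).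
by apply: measurable_funM => //; exact: measurable_funB.
Qed.

(** Tonelli, then the Gaussian substitution for each fixed r. Since r < 1, the variance v (1 - r) is
    positive and the law is not degenerate. *)
Lemma ge0_integral_mixture (f : R -> R) (M : R) : continuous f ->
  (forall y, 0 <= f y) -> (forall y, `|f y| <= M) ->
  (\int[mu]_y ((f y)%:E * q y) =
   \int[m]_(r in I01) (gauss_mean f (a r) (Num.sqrt (v * (1 - r))))%:E)%E.
Proof.
move=> cf f0 fM.
pose F (p : R * R) :=
  (\1_I01 p.2 * (f p.1 * gauss_pdf (a p.2) (v * (1 - p.2)) p.1))%:E.
have F0 p : (0 <= F p)%E by rewrite lee_fin !mulr_ge0// normal_pdf_ge0.
have mF : measurable_fun setT F.
  apply/measurable_EFinP; apply: measurable_funM.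
    exact: (measurableT_comp (f := (\1_I01 : R -> R))).
  apply: measurable_funM => //; apply: measurableT_comp => //.
  exact: continuous_measurable_fun.
transitivity (\int[mu]_y \int[m]_r F (y, r))%E.
  apply: eq_integral => y _; rewrite integral_indicM -ge0_integralZl//.
  - by apply: eq_integral => r _; rewrite -EFinM mulrCA.
  - apply/measurable_EFinP; apply: measurable_funM => //.
    exact: (measurableT_comp mpdf (measurable_pair1 y)).
  - by move=> r _; rewrite lee_fin mulr_ge0// normal_pdf_ge0.
  - by rewrite lee_fin.
transitivity (\int[m]_r \int[mu]_y F (y, r))%E;
  first exact: (@fubini_tonelli _ _ _ _ _ mu m F mF F0).
rewrite integral_indicM.
apply: eq_integral => r _; rewrite /F/= indicE.
have [|nr] := boolP (r \in I01); last first.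
  by under eq_integral do rewrite mul0r; rewrite integral0 mul0r.
rewrite inE/= in_itv/= => /andP[r0 r1].
under eq_integral do rewrite mul1r; rewrite mul1r.
rewrite (integral_normal_pdf_gauss_mean _ _ cf fM)//.
by rewrite sqrtr_gt0 mulr_gt0// subr_gt0.
Qed.

Lemma measurable_mixture : measurable_fun setT (fun y => q y).
Proof.
under eq_fun do rewrite integral_indicM.
apply: (@measurable_fun_fubini_tonelli_F _ _ _ _ _ m
  (fun p : R * R => (\1_I01 p.2 * gauss_pdf (a p.2) (v * (1 - p.2)) p.1)%:E)).
- apply/measurable_EFinP; apply: measurable_funM => //.
  exact: (measurableT_comp (f := (\1_I01 : R -> R))).
- by move=> p; rewrite lee_fin mulr_ge0// normal_pdf_ge0.
Qed.

Lemma mixture_ge0 y : (0 <= q y)%E.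
Proof. by apply: integral_ge0 => r _; rewrite lee_fin normal_pdf_ge0. Qed.

End fixed_mixture.

Lemma continuous_gauss_mean (f a b : R -> R) (M L : R) : continuous f ->
  (forall x, `|f x| <= M) -> 0 <= L -> (forall x y, `|f x - f y| <= L * `|x - y|) ->
  continuous a -> continuous b -> continuous (fun r => gauss_mean f (a r) (b r)).
Proof.
move=> cf fM L0 fL ca cb r; apply/cvgrPdist_lt => e e0.
have H : L * (`|a r - a s| + `|b r - b s|) @[s --> r] --> (0 : R).
  have -> : (0 : R) = L * (`|a r - a r| + `|b r - b r|) by rewrite !subrr normr0 addr0 mulr0.
  apply: cvgMl_tmp; apply: cvgD; apply: cvg_norm; apply: cvgB;
    [exact: cvg_cst|exact: ca|exact: cvg_cst|exact: cb].
move/cvgrPdist_lt : H => /(_ e e0); apply: filterS => s.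
rewrite sub0r normrN => /(le_lt_trans (ler_norm _)); apply: le_lt_trans.
exact: (gauss_mean_lipschitz _ _ cf fM).
Qed.

End mixture.

Section mixture_signed.
Context {R : realType}.
Notation mu := (@lebesgue_measure R).
Local Notation I01 := (`[0%R, 1%R[%classic : set R).

(** Reduces a bounded function to the nonnegative [f + M], to which the density formula applies;
    total mass 1 makes the correction exactly [M]. *)
Lemma Rintegral_addr_cst (rho : {measure set R -> \bar R}) (f : R -> R) (M : R) :
  rho setT = 1%E -> continuous f -> (forall x, `|f x| <= M) ->
  \int[rho]_x f x = \int[rho]_x (f x + M) - M.
Proof.
move=> rho1 cf fM; have rhooo : (rho setT < +oo)%E by rewrite rho1 ltry.
have if_ : rho.-integrable setT (EFin \o f).
  by apply: (@bounded_integrable _ _ _ _ _ _ M) => //; exact: continuous_measurable_fun.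
have iM : rho.-integrable setT (EFin \o cst M).
  by apply: (@bounded_integrable _ _ _ _ _ _ `|M|).
rewrite RintegralD// Rintegral_cst//.
have -> : fine (rho [set: R]) = 1 by rewrite rho1.
by rewrite mulr1 addrK.
Qed.

Lemma addr_bound_ge0 (f : R -> R) (M : R) : (forall x, `|f x| <= M) ->
  (forall x, 0 <= f x + M) /\ (forall x, `|f x + M| <= M + M).
Proof.
move=> fM; split=> x; have := fM x; rewrite ler_norml => /andP[h1 h2].
  by rewrite -lerBlDr sub0r.
by rewrite ger0_norm ?lerD2r// -lerBlDr sub0r.
Qed.

Lemma continuous_addr_cst (f : R -> R) (M : R) : continuous f ->
  continuous (fun x => f x + M).
Proof. by move=> cf x; apply: cvgD; [exact: cf|exact: cvg_cst]. Qed.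

Lemma continuous_sqrt_onem (v : R) : continuous (fun r : R => Num.sqrt (v * (1 - r))).
Proof.
move=> r; apply: continuous_comp; last exact: sqrt_continuous.
by apply: cvgM; [exact: cvg_cst|apply: cvgB; [exact: cvg_cst|exact: cvg_id]].
Qed.

Section integrals.
Variables (f : R -> R) (M L : R).
Hypotheses (cf : continuous f) (fM : forall x, `|f x| <= M) (L0 : 0 <= L)
  (fL : forall x y, `|f x - f y| <= L * `|x - y|).

Lemma integrable_gauss_mean_path (m : probability R R) (a b : R -> R) :
  continuous a -> continuous b ->
  m.-integrable I01 (EFin \o (fun r => gauss_mean f (a r) (b r))).
Proof.
move=> ca cb; apply: (@integrable_itv01 _ _ _ M).
  apply: measurable_funTS; apply: continuous_measurable_fun.
  exact: (continuous_gauss_mean _ _ _ M L).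
by move=> r _; exact: (gauss_mean_le _ _ cf fM).
Qed.

Lemma Rintegral_gauss_meanD (m : probability R R) (a b : R -> R) (k : R) :
  continuous a -> continuous b ->
  \int[m]_(r in I01) gauss_mean (fun x => f x + k) (a r) (b r) =
  \int[m]_(r in I01) gauss_mean f (a r) (b r) + k * fine (m I01).
Proof.
move=> ca cb; rewrite -[in RHS]Rintegral_cst// -RintegralD//.
- by apply: eq_Rintegral => r _; rewrite (gauss_meanD _ _ cf fM).
- exact: integrable_gauss_mean_path.
- by apply: (@integrable_itv01 _ _ _ `|k|).
Qed.

End integrals.

Lemma gauss_mean_cst (k a b : R) : gauss_mean (cst k) a b = k.
Proof. by rewrite /gauss_mean Rintegral_normal_cst. Qed.

Section mixture.
Variables (m : probability R R) (a : R -> R) (v : R).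
Hypotheses (ca : continuous a) (v0 : 0 < v).
Local Notation q y := (\int[m]_(r in I01) (gauss_pdf (a r) (v * (1 - r)) y)%:E)%E.
Local Notation rq y := (\int[m]_(r in I01) gauss_pdf (a r) (v * (1 - r)) y).
Let ma : measurable_fun setT a. Proof. exact: continuous_measurable_fun. Qed.

(** The mixture formula for the constant 1 gives the mass of [0, 1) under [m]. Consequently [q] is
    finite almost everywhere, and the real-valued [rq] can stand for it under an integral. *)
Lemma integrable_mixture : mu.-integrable setT (fun y => q y).
Proof.
apply/integrableP; split; first exact: measurable_mixture.
have -> : (\int[mu]_y `|q y| = \int[mu]_y ((cst 1%R y)%:E * q y))%E.
  by apply: eq_integral => y _; rewrite gee0_abs ?mixture_ge0//= mul1e.
rewrite [X in (X < +oo)%E](_ : _ = (\int[m]_(r in I01)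
  (gauss_mean (cst 1) (a r) (Num.sqrt (v * (1 - r))))%:E)%E); last first.
  apply: (ge0_integral_mixture m a v ma v0 (cst 1) 1).
  - by move=> y; exact: cst_continuous.
  - by move=> y; exact: ler01.
  - by move=> y; rewrite normr1.
under eq_integral do rewrite gauss_mean_cst.
by rewrite integral_cst// mul1e probability_lty.
Qed.

Lemma ge0_Rintegral_mixture (h : R -> R) (M L : R) : continuous h ->
  (forall y, `|h y| <= M) -> 0 <= L -> (forall x y, `|h x - h y| <= L * `|x - y|) ->
  (forall y, 0 <= h y) ->
  mu.-integrable setT (EFin \o (fun y => h y * rq y)) /\
  \int[mu]_y (h y * rq y) =
  \int[m]_(r in I01) gauss_mean h (a r) (Num.sqrt (v * (1 - r))).
Proof.
move=> ch hM L0 hL h0.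
have mq : measurable_fun setT (fun y => q y) by exact: measurable_mixture.
have mh : measurable_fun setT h by exact: continuous_measurable_fun.
have E : (\int[mu]_y (h y * rq y)%:E = \int[mu]_y ((h y)%:E * q y))%E.
  apply: ae_eq_integral => //.
  - apply/measurable_EFinP; apply: measurable_funM => //.
    exact: (measurableT_comp (fine_measurable measurableT) mq).
  - by apply: emeasurable_funM => //; exact/measurable_EFinP.
  - have := integrable_ae measurableT integrable_mixture.
    by apply: filterS => y /(_ I) qfin _; rewrite EFinM /Rintegral fineK.
have E2 : (\int[mu]_y (h y * rq y)%:E = (\int[m]_(r in I01)
    gauss_mean h (a r) (Num.sqrt (v * (1 - r))))%:E)%E.
  rewrite E; transitivity (\int[m]_(r in I01)
      (gauss_mean h (a r) (Num.sqrt (v * (1 - r))))%:E)%E.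
    exact: (ge0_integral_mixture _ _ _ ma v0 _ _ ch h0 hM).
  rewrite /Rintegral fineK//; apply: integrable_fin_num => //.
  exact: (integrable_gauss_mean_path _ _ _ ch hM L0 hL _ _ _ ca (continuous_sqrt_onem v)).
split; last by rewrite /Rintegral E2.
apply/integrableP; split.
  apply/measurable_EFinP; apply: measurable_funM => //.
  exact: (measurableT_comp (fine_measurable measurableT) mq).
suff -> : (\int[mu]_y `|(h y * rq y)%:E| = \int[mu]_y (h y * rq y)%:E)%E by rewrite E2 ltry.
apply: eq_integral => y _; rewrite gee0_abs// lee_fin mulr_ge0//; apply: Rintegral_ge0 => r _.
exact: normal_pdf_ge0.
Qed.

(** The nonnegative case is applied to [g + M] and to the constant [M], and the results are
    subtracted; [m] may give [0, 1) less than full mass, and the corresponding terms cancel. *)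
Lemma Rintegral_mixture (g : R -> R) (M L : R) : continuous g ->
  (forall y, `|g y| <= M) -> 0 <= L -> (forall x y, `|g x - g y| <= L * `|x - y|) ->
  \int[mu]_y (g y * rq y) =
  \int[m]_(r in I01) gauss_mean g (a r) (Num.sqrt (v * (1 - r))).
Proof.
move=> cg gM L0 gL; have [h0 hM] := addr_bound_ge0 _ _ gM.
have M0 : 0 <= M by exact: le_trans (gM 0).
have [i1 E1] := ge0_Rintegral_mixture _ _ L (continuous_addr_cst _ M cg) hM L0
  (fun x y => ltac:(by rewrite opprD addrACA subrr addr0)) h0.
have [i2 E2] := ge0_Rintegral_mixture (cst M) M 0 (@cst_continuous _ _ M)
  (fun=> ltac:(by rewrite /= ger0_norm)) (lexx 0)
  (fun x y => ltac:(by rewrite /= subrr normr0 mul0r)) (fun=> M0).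
transitivity (\int[mu]_y ((g y + M) * rq y - cst M y * rq y)).
  by apply: eq_Rintegral => y _; rewrite /= mulrDl addrK.
have E3 : \int[m]_(r in I01) gauss_mean (cst M) (a r) (Num.sqrt (v * (1 - r))) =
    M * fine (m I01).
  rewrite -Rintegral_cst//; apply: eq_Rintegral => r _; exact: gauss_mean_cst.
transitivity (\int[mu]_y ((g y + M) * rq y) - \int[mu]_y (cst M y * rq y)).
  exact: (RintegralB measurableT i1 i2).
rewrite E1 E2 E3 (Rintegral_gauss_meanD _ _ _ cg gM L0 gL _ _ _ _ ca (continuous_sqrt_onem v)).
exact: addrK.
Qed.

End mixture.
End mixture_signed.

(* Lebesgue measure lives on [measurableTypeR R], whose display differs from
   that of the canonical measurable structure on [R]; [borel_id] converts. *)
Definition borel_id {R : realType} : measurableTypeR R -> R := idfun.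

(** The density formula wants its measures on one measurable space, so Lebesgue measure is pushed
    forward along [borel_id], which leaves integrals unchanged. *)
Lemma ge0_integral_lebesgue_density {R : realType}
    (rho m0 : {measure set R -> \bar R}) (g : R -> \bar R) :
  measurable_fun setT g -> (forall x, 0 <= g x)%E ->
  (forall A, measurable A ->
    rho A = m0 A + \int[lebesgue_measure]_(x in A) g x)%E ->
  forall f, measurable_fun setT f -> (forall x, 0 <= f x)%E ->
  (\int[rho]_x f x = \int[m0]_x f x + \int[lebesgue_measure]_x (f x * g x))%E.
Proof.
move=> mg g0 rhoE f mf f0.
have mid : measurable_fun setT (@borel_id R) by exact: measurable_id.
pose leb : {measure set R -> \bar R} := pushforward lebesgue_measure (@borel_id R).
pose mu' := leb mid.
have mu'E (D : set R) (h : R -> \bar R) : measurable D -> measurable_fun setT h ->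
    (forall x, 0 <= h x)%E ->
    (\int[mu']_(x in D) h x = \int[lebesgue_measure]_(x in D) h x)%E.
  move=> mD mh h0; rewrite ge0_integral_pushforward//; exact: measurable_funTS.
rewrite (@ge0_integral_density _ _ _ rho m0 mu' g)//.
- congr (_ + _)%E; rewrite mu'E//; first exact: emeasurable_funM.
  by move=> x; exact: mule_ge0.
- by move=> A mA; rewrite rhoE// mu'E.
Qed.

(** * Integrals against the transition laws *)

Section transition_integral.
Context {R : realType}.
Notation mu := (@lebesgue_measure R).
Local Notation I01 := (`[0%R, 1%R[%classic : set R).
Variable G : R -> probability R R.

Lemma transition0E (t x : R) (A : set R) :
  transition G 0 t x A = (\int[mu]_(y in A) (gauss_pdf x t y)%:E)%E.
Proof. by rewrite /transition eqxx. Qed.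

Lemma transitionE (s t x : R) (A : set R) : 0 < s ->
  transition G s t x A = ((mass_at1 G (Num.sqrt (t / s)))%:E *
    \d_(Num.sqrt (t / s) * x)%R A +
    \int[mu]_(y in A) transition_density G s t x y)%E.
Proof. by move=> s0; rewrite /transition gt_eqF. Qed.

Lemma ge0_integral_transition0 (t x : R) (f : R -> R) (M : R) : 0 < t ->
  continuous f -> (forall y, 0 <= f y) -> (forall y, `|f y| <= M) ->
  (\int[transition G 0 t x]_y (f y)%:E = (gauss_mean f x (Num.sqrt t))%:E)%E.
Proof.
move=> t0 cf f0 fM.
rewrite (@ge0_integral_lebesgue_density R (transition G 0 t x) mzero
  (fun y => (gauss_pdf x t y)%:E))//.
- rewrite integral_measure_zero add0e.
  rewrite -(integral_normal_pdf_gauss_mean _ _ cf fM)// ?sqrtr_gt0//.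
- by apply/measurable_EFinP; exact: measurable_normal_pdf.
- by move=> y; rewrite lee_fin normal_pdf_ge0.
- move=> A mA; transitivity (\int[mu]_(y in A) (gauss_pdf x t y)%:E)%E.
    exact: transition0E.
  by rewrite -[LHS]add0e.
- by apply/measurable_EFinP; exact: continuous_measurable_fun.
Qed.

Lemma Rintegral_transition0 (t x : R) (f : R -> R) (M : R) : 0 < t ->
  continuous f -> (forall y, `|f y| <= M) ->
  \int[transition G 0 t x]_y f y = gauss_mean f x (Num.sqrt t).
Proof.
move=> t0 cf fM; have [h0 hM] := addr_bound_ge0 _ _ fM.
rewrite (@Rintegral_addr_cst _ (transition G 0 t x) f M)//; last first.
  have E := ge0_integral_transition0 t x (cst 1) 1 t0 (@cst_continuous _ _ (1 : R))
    (fun=> ler01) (fun=> ltac:(by rewrite /= normr1)).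
  rewrite gauss_mean_cst in E; rewrite -E.
  transitivity (1 * transition G 0 t x setT)%E; first by rewrite mul1e.
  exact/esym/(integral_cst (transition G 0 t x) measurableT 1%E).
rewrite /Rintegral (ge0_integral_transition0 _ _ _ _ t0 (continuous_addr_cst _ M cf) h0 hM)/=.
by rewrite (gauss_meanD _ _ cf fM) addrK.
Qed.

Section positive_time.
Variables (s t x : R).
Hypotheses (s0 : 0 < s) (st : s < t).
Hypothesis G1 : G (Num.sqrt (t / s)) I01 = (1 - mass_at1 G (Num.sqrt (t / s)))%:E.
Local Notation sigma := (Num.sqrt (t / s)).

Let ca : continuous (fun r => sigma * Num.sqrt r * x).
Proof.
by move=> r; apply: cvgMr_tmp; apply: cvgMl_tmp; exact: sqrt_continuous.
Qed.

Let t0 : 0 < t. Proof. exact: lt_trans st. Qed.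

Let g0 : 0 <= mass_at1 G sigma. Proof. by rewrite fine_ge0. Qed.

(** The atom is the summand [m0] of the density formula, a scaled Dirac mass at [sigma * x]; the
    absolutely continuous part is a Gaussian mixture over [G sigma]. *)
Lemma ge0_integral_transition (f : R -> R) (M : R) : continuous f ->
  (forall y, 0 <= f y) -> (forall y, `|f y| <= M) ->
  (\int[transition G s t x]_y (f y)%:E =
   (mass_at1 G sigma * f (sigma * x))%:E + \int[G sigma]_(r in I01)
     (gauss_mean f (sigma * Num.sqrt r * x) (Num.sqrt (t * (1 - r))))%:E)%E.
Proof.
move=> cf f0 fM.
have ma := continuous_measurable_fun ca.
have mf : measurable_fun setT (fun y => (f y)%:E).
  by apply/measurable_EFinP; exact: continuous_measurable_fun.
rewrite (@ge0_integral_lebesgue_density R (transition G s t x)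
  (mscale (NngNum g0) \d_(sigma * x)) (transition_density G s t x))//.
- congr (_ + _)%E.
    rewrite ge0_integral_mscale// => [|y _]; last by rewrite lee_fin.
    by rewrite integral_dirac// diracT mul1e EFinM.
  exact: (ge0_integral_mixture (G sigma) _ t ma t0 f M).
- exact: (measurable_mixture (G sigma) _ t ma).
- by move=> y; exact: mixture_ge0.
- by move=> A mA; exact: transitionE.
Qed.

Lemma Rintegral_transition (f : R -> R) (M L : R) : continuous f ->
  (forall y, `|f y| <= M) -> 0 <= L -> (forall x y, `|f x - f y| <= L * `|x - y|) ->
  \int[transition G s t x]_y f y =
   mass_at1 G sigma * f (sigma * x) + \int[G sigma]_(r in I01)
     gauss_mean f (sigma * Num.sqrt r * x) (Num.sqrt (t * (1 - r))).
Proof.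
move=> cf fM L0 fL; have [h0 hM] := addr_bound_ge0 _ _ fM.
rewrite (@Rintegral_addr_cst _ (transition G s t x) f M)//; last first.
  (* The formula for the constant 1 shows that the law has total mass 1: [G1] says that the atom of
     [G sigma] and [0, 1) share the whole mass. *)
  have E := ge0_integral_transition (cst 1) 1 (@cst_continuous _ _ (1 : R))
    (fun=> ler01) (fun=> ltac:(by rewrite /= normr1)).
  transitivity (1 * transition G s t x setT)%E; first by rewrite mul1e.
  transitivity (\int[transition G s t x]_y (cst 1 y)%:E)%E.
    exact/esym/(integral_cst (transition G s t x) measurableT 1%E).
  rewrite E; under [X in (_ + X)%E]eq_integral do rewrite gauss_mean_cst.
  transitivity ((mass_at1 G sigma)%:E + 1 * G sigma I01)%E.
    by congr (_ + _)%E; [rewrite mulr1|exact: (integral_cst (G sigma) _ 1%E)].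
  by rewrite mul1e G1 -EFinD subrKC.
have cb := continuous_sqrt_onem t.
have hL y z : `|f y + M - (f z + M)| <= L * `|y - z|.
  by rewrite opprD addrACA subrr addr0.
have ch := continuous_addr_cst _ M cf.
have iT := integrable_gauss_mean_path _ _ _ ch hM L0 hL (G sigma) _ _ ca cb.
have -> : \int[transition G s t x]_y (f y + M) = mass_at1 G sigma * (f (sigma * x) + M) +
    \int[G sigma]_(r in I01)
      gauss_mean (fun y => f y + M) (sigma * Num.sqrt r * x) (Num.sqrt (t * (1 - r))).
  rewrite /Rintegral (ge0_integral_transition _ _ ch h0 hM) fineD//.
  exact: (integrable_fin_num _ iT).
rewrite (Rintegral_gauss_meanD _ _ _ cf fM L0 fL _ _ _ _ ca cb).
have -> : fine (G sigma I01) = 1 - mass_at1 G sigma by rewrite G1.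
by ring.
Qed.

End positive_time.
End transition_integral.

(** * The Levy measure and the limit law *)

Section laplace.
Context {R : realType}.
Variables (G : R -> probability R R) (psi : R -> R).
Hypothesis hG : log_convolution_semigroup G.
Hypothesis hpsi : has_laplace_exponent G psi.
Hypothesis hpsi_half : psi 2^-1 = 1.
Hypothesis hgamma : forall sigma : R, 1 <= sigma -> 0 < mass_at1 G sigma.
Local Notation I01 := `[0%R, 1%R[%classic.
Local Notation gamma := (mass_at1 G).

Lemma mass_at1E (s : R) : (gamma s)%:E = G s [set 1].
Proof. by rewrite /mass_at1 fineK// fin_num_measure. Qed.

Lemma ge0_integral_carrier (s : R) (f : R -> \bar R) : 1 <= s ->
  measurable_fun setT f -> (forall r, 0 <= f r)%E ->
  (\int[G s]_r f r = \int[G s]_(r in I01) f r + f 1%R * (gamma s)%:E)%E.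
Proof.
move=> s1 mf f0.
have m01 : measurable (`[0%R, 1%R]%classic : set R) by [].
rewrite (@ge0_negligible_integral _ _ _ (G s) setT (~` `[0, 1]))//; last 2 first.
- exact: measurableC.
- by have := probability_setC (G s) m01; rewrite (lcs_carrier hG s1) subee.
have -> : [set: R] `\` ~` `[0, 1] = I01 `|` [set 1].
  rewrite setTD setCK; apply/seteqP; split => r /=; rewrite !in_itv/=.
    by move=> /andP[->]; rewrite le_eqVlt => /predU1P[->|->]; [right|left].
  by case=> [/andP[-> /ltW->]//|->]; rewrite ler01 lexx.
rewrite ge0_integral_setU//=.
- congr (_ + _)%E; rewrite mass_at1E -integral_cst//.
  by apply: eq_integral => r; rewrite inE => ->.
- exact: measurable_funTS.
- by apply/disj_setPRL => r /= ->; rewrite in_itv/= ltxx andbF.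
Qed.

(** [G s] is carried by [0, 1], and its atom at 1 contributes [gamma s] whatever the exponent. *)
Lemma expectation_powR (s l : R) : 1 <= s -> 0 < l ->
  (\int[G s]_(r in I01) (r `^ l)%:E + (gamma s)%:E = (s `^ (- psi l))%:E)%E.
Proof.
move=> s1 l0; have [b [nu [_ [_ /(_ _ _ s1 l0) <-]]]] := hpsi.
rewrite unlock ge0_integral_carrier//.
- by rewrite powR1 mul1e.
- by apply/measurable_EFinP; exact: measurable_powR.
- by move=> r; rewrite lee_fin powR_ge0.
Qed.

Lemma moment_G (s : R) (n : nat) : 1 <= s -> (0 < n)%N ->
  moment (G s) n = s `^ (- psi n%:R) - gamma s.
Proof.
move=> s1 n0; have nR : 0 < n%:R :> R by rewrite ltr0n.
rewrite /moment /Rintegral.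
have -> : (\int[G s]_(r in I01) (r ^+ n)%:E = \int[G s]_(r in I01) (r `^ n%:R)%:E)%E.
  by apply: eq_integral => r; rewrite inE/= in_itv/= => /andP[r0 _]; rewrite powR_mulrn.
have := expectation_powR _ _ s1 nR.
case: (\int[G s]_(r in I01) (r `^ n%:R)%:E)%E => [x| |] //=.
by rewrite -EFinD => -[<-]; rewrite addrK.
Qed.

Lemma mass_at1_le (s l : R) : 1 <= s -> 0 < l -> gamma s <= s `^ (- psi l).
Proof.
move=> s1 l0; rewrite -lee_fin -expectation_powR// leeDr// integral_ge0// => r _.
by rewrite lee_fin powR_ge0.
Qed.

Lemma measure_below1 (s : R) : 1 <= s -> G s I01 = (1 - gamma s)%:E.
Proof.
move=> s1; have h : (G s I01 + G s [set 1%R] = 1)%E.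
  rewrite -measureU//; last first.
    by apply/seteqP; split => // r [/= + r1]; rewrite r1 in_itv/= ltxx andbF.
  rewrite -(lcs_carrier hG s1); congr (G s _); apply/seteqP; split => r /=; rewrite !in_itv/=.
    by case=> [/andP[-> /ltW->]//|->]; rewrite ler01 lexx.
  by move=> /andP[->]; rewrite le_eqVlt => /predU1P[->|->]; [right|left].
by rewrite EFinB -h mass_at1E addeK// fin_num_measure.
Qed.

(** At sigma = 2 the atom gives 0 < gamma(2) <= 2^(- psi(n)); logarithms give a bound that does not
    depend on n. *)
Lemma psi_nat_bounded : exists K : R, forall n : nat, (0 < n)%N -> psi n%:R <= K.
Proof.
have ln2 : 0 < ln 2 :> R by rewrite ln_gt0// ltr1n.
exists (- ln (gamma 2) / ln 2) => n n0.
have g2 : 0 < gamma 2 by apply: hgamma; rewrite ler1n.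
rewrite ler_pdivlMr// lerNr -mulNr -ln_powR ler_ln ?posrE ?powR_gt0//.
by apply: mass_at1_le; rewrite ?ler1n// ltr0n.
Qed.

(** Both terms of psi(n) are nonnegative and their sum is at most [K]. The linear term must
    therefore vanish, and as 1 - exp(- n x) increases to the indicator of x > 0 on the half-line,
    monotone convergence shows both that [nu] has mass at most [K] and that psi(n) tends to this
    mass. *)
Lemma laplace_exponent_finite : exists nu : {measure set R -> \bar R},
  [/\ nu [set 0] = 0%E, (nu `[0%R, +oo[ < +oo)%E,
    (forall n, (0 < n)%N -> psi n%:R =
        \int[nu]_(x in `[0, +oo[) (1 - expR (- (n%:R * x)))) &
    psi n%:R @[n --> \oo] --> fine (nu `[0, +oo[) ].
Proof.
have [K hK] := psi_nat_bounded.
have [b [nu [[b0 _ nu0 numin] [psiE _]]]] := hpsi.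
pose f (n : nat) (x : R) := 1 - expR (- (n%:R * x)).
have f0 n x : 0 <= x -> 0 <= f n x.
  by move=> x0; rewrite subr_ge0 -expR0 ler_expR oppr_le0 mulr_ge0.
have mf n : measurable_fun setT (f n).
  apply: measurable_funB => //; apply: measurableT_comp => //.
  by apply: measurableT_comp => //; exact: measurable_funM.
have itvE (x : R) : (`[0, +oo[%classic : set R) x = (0 <= x) :> Prop.
  by rewrite /= in_itv/= andbT.
have if_ n : nu.-integrable `[0, +oo[ (EFin \o f n).
  (* Domination by n min(1, x), which is integrable by the condition on the Levy measure. *)
  apply: (@le_integrable _ _ _ nu _ _ _ (fun x => n%:R%:E * (Num.min 1 x)%:E)%E) => //.
  - exact/measurable_EFinP/measurable_funTS.
  - move=> x; rewrite itvE => x0; rewrite -EFinM !gee0_abs ?lee_fin ?f0//; last first.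
      by rewrite mulr_ge0// le_min ler01.
    rewrite minr_pMr// mulr1 le_min; apply/andP; split; last first.
      by rewrite lerBlDr -lerBlDl (le_trans _ (expR_ge1Dx _)).
    rewrite /f; case: (n) => [|k]; first by rewrite mul0r oppr0 expR0 subrr.
    by rewrite (@le_trans _ _ 1)// ?ler1n// gerBl expR_ge0.
  - apply: integrableZl => //; apply/integrableP; split.
      by apply/measurable_EFinP/measurable_funTS; exact: measurable_minr.
    apply: le_lt_trans numin; rewrite le_eqVlt; apply/predU1P; left.
    apply: eq_integral => x; rewrite inE itvE => x0.
    by rewrite gee0_abs// lee_fin le_min ler01.
have fl n : (0 < n)%N -> b * n%:R + \int[nu]_(x in `[0, +oo[) f n x <= K.
  by move=> n0; rewrite -psiE ?ltr0n// hK.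
have fI0 n : 0 <= \int[nu]_(x in `[0, +oo[) f n x.
  by apply: Rintegral_ge0 => x; rewrite itvE; exact: f0.
have {b0} b0 : b = 0.
  apply/eqP; rewrite eq_le b0 andbT leNgt; apply/negP => bgt0.
  (* An integer n > K / b would make the linear term alone exceed [K]. *)
  have := fl (Num.truncn (K / b)).+1 isT; apply/negP; rewrite -ltNge.
  rewrite ltr_wpDr// mulrC -ltr_pdivrMr//; exact: Num.Theory.truncnS_gt.
have fK n : (\int[nu]_(x in `[0%R, +oo[) (f n x)%:E =
    (\int[nu]_(x in `[0, +oo[) f n x)%:E)%E.
  by rewrite /Rintegral fineK//; exact: integrable_fin_num (if_ n).
(* The monotone limit is the indicator of the complement of 0; because [nu [set 0] = 0] it still
   carries the whole mass. *)
have mnu : nu (~` [set 0] `&` `[0%R, +oo[) = nu `[0, +oo[.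
  have m0y : measurable (`[0%R, +oo[%classic : set R) by [].
  rewrite -[in RHS](setIT `[0%R, +oo[%classic) -(setUv [set 0]) setIUr measureU//.
  - by rewrite setIC [X in (X + _)%E](_ : _ = 0%E) ?add0e// -nu0; congr (nu _);
      apply/seteqP; split => [x []//|x /= ->]; rewrite in_itv/= lexx.
  - exact: measurableI.
  - by apply: measurableI => //; exact: measurableC.
  - by apply/seteqP; split => [x [[_ /= ->] [_ /= ]]|].
have cv : (\int[nu]_(x in `[0%R, +oo[) (f n x)%:E)%E @[n --> \oo] --> nu `[0, +oo[.
  rewrite -mnu -integral_indic//; last exact: measurableC.
  apply: (@cvg_nondecreasing_integral _ _ _ nu `[0%R, +oo[%classic
    (fun n x => (f n x)%:E)) => //.
  - by move=> n; exact/measurable_EFinP/measurable_funTS.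
  - by move=> n x; rewrite itvE lee_fin; exact: f0.
  - move=> x; rewrite itvE => x0 m n mn; rewrite lee_fin lerB// ler_expR lerN2.
    by rewrite ler_wpM2r// ler_nat.
  - move=> x; rewrite itvE le_eqVlt => /predU1P[<-|x0].
      rewrite indicE/= (_ : _ \in _ = false) ?mulr0n; last first.
        by apply/negbTE; rewrite notin_setE/=; apply.
      by apply: cvg_near_cst; apply: nearW => n; rewrite /f mulr0 oppr0 expR0 subrr.
    rewrite indicE mem_set/=; last by apply/eqP; rewrite gt_eqF.
    apply: cvg_EFin; first exact: nearW.
    rewrite -[X in _ --> X]subr0; apply: cvgB; first exact: cvg_cst.
    apply: (cvg_comp (fun n => n%:R) (fun y => expR (- (y * x)))); first exact: cvgr_idn.
    apply: (cvg_comp (fun y => y * x) (fun y => expR (- y))); last exact: cvgr_expR.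
    by apply: gt0_cvgMly => //; exact: cvg_id.
have nuK : (nu `[0%R, +oo[ <= K%:E)%E.
  rewrite -(cvg_lim _ cv)//; apply: lime_le; first by apply/cvg_ex; exists (nu `[0, +oo[).
  near=> n; rewrite fK lee_fin; have := fl n; rewrite b0 mul0r add0r; apply.
  by near: n; exists 1%N.
have nufin : (nu `[0%R, +oo[ < +oo)%E by rewrite (le_lt_trans nuK)// ltry.
exists nu; split => //.
  by move=> n n0; rewrite psiE ?ltr0n// b0 mul0r add0r.
have : \int[nu]_(x in `[0, +oo[) f n x @[n --> \oo] --> fine (nu `[0, +oo[).
  by apply: fine_cvg; rewrite fineK// ge0_fin_numE.
apply: cvg_trans; apply: near_eq_cvg; near=> n.
have n0 : (0 < n)%N by near: n; exists 1%N.
by rewrite psiE ?ltr0n// b0 mul0r add0r.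
Unshelve. all: by end_near. Qed.

End laplace.

(** * Right difference quotients *)

Section right_quotient.
Context {R : realType}.

(** Passes between quotients in the increment [h], as in [right_derivative], and quotients in the
    endpoint [t], as in [has_generator]. *)
Lemma cvg_at_right_shift (F : R -> R) (x l : R) :
  F (x + h) @[h --> 0^'+] --> l <-> F t @[t --> x^'+] --> l.
Proof.
split=> /cvgrPdist_lt H; apply/cvgrPdist_lt => e e0;
  have /nbhs_ballP[r /= r0 hr] := H e e0; apply/nbhs_ballP; exists r => //= t;
  rewrite /ball/= => tr t0.
- rewrite -(subrKC x t); apply: hr; last by rewrite subr_gt0.
  by rewrite /ball/= sub0r normrN distrC.
- apply: hr; last by rewrite ltrDl.
  by rewrite /ball/= opprD addNKr normrN; rewrite sub0r normrN in tr.
Qed.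

Lemma is_derive_cvg_right (f : R -> R) (x df : R) : is_derive x 1 f df ->
  (t - x)^-1 * (f t - f x) @[t --> x^'+] --> df.
Proof.
move=> [dfx <-]; apply/cvg_at_right_shift.
have /cvgrPdist_lt H := dfx; apply/cvgrPdist_lt => e e0.
have /nbhs_ballP[r /= r0 hr] := H e e0; apply/nbhs_ballP; exists r => //= h.
rewrite /ball/= => hrr h0; have := hr h; rewrite /ball/= => /(_ hrr).
rewrite gt_eqF// => /(_ isT); rewrite addrAC subrr add0r /GRing.scale/= mulr1.
by rewrite (addrC h).
Qed.

Lemma powR_cvg_right1 (a : R) : (s - 1)^-1 * (s `^ a - 1) @[s --> 1^'+] --> a.
Proof.
have := is_derive_cvg_right _ _ _ (@is_derive1_powR R a 1 ltr01).
by rewrite powR1 mulr1.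
Qed.

Lemma expR_opp_measurable : measurable_fun setT (fun x : R => expR (- x)).
Proof. by apply: measurableT_comp => //; exact: measurable_oppr. Qed.

End right_quotient.

(** Named so that a measurable-function structure can be attached to it, as [distribution]
    demands. *)
Definition expR_opp {R : realType} (x : R) : R := expR (- x).

HB.instance Definition _ (R : realType) := isMeasurableFun.Build _ _ _ _
  (@expR_opp R) (@expR_opp_measurable R).

Section laplace_limit.
Context {R : realType}.
Variables (G : R -> probability R R) (psi : R -> R).
Hypothesis hG : log_convolution_semigroup G.
Hypothesis hpsi : has_laplace_exponent G psi.
Hypothesis hpsi_half : psi 2^-1 = 1.
Variable c : R.
Hypothesis hc : psi n%:R @[n --> \oo] --> c.
Local Notation I01 := `[0%R, 1%R[%classic.
Local Notation gamma := (mass_at1 G).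

(** The n-th moment of [G s] on [0, 1) is s^(- psi(n)) - gamma(s). As n grows it tends to 0, and
    also to s^(-c) - gamma(s). *)
Lemma mass_at1_powR (s : R) : 1 <= s -> gamma s = s `^ (- c).
Proof.
move=> s1; have s0 : s != 0 by rewrite gt_eqF// (lt_le_trans _ s1).
have c1 : s `^ (- psi n%:R) - gamma s @[n --> \oo] --> s `^ (- c) - gamma s.
  apply: cvgB; last exact: cvg_cst.
  rewrite /powR (negbTE s0).
  apply: (cvg_comp (fun n => - psi n%:R * ln s) expR); last exact: continuous_expR.
  by apply: cvgMr_tmp; exact: cvgN.
have c2 : s `^ (- psi n%:R) - gamma s @[n --> \oo] --> 0.
  apply: cvg_trans (moment_cvg0 (G s)); apply: near_eq_cvg; near=> n.
  by rewrite (moment_G _ _ hG hpsi)//; near: n; exists 1%N.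
by apply/esym/eqP; rewrite -subr_eq0; apply/eqP; exact: (cvg_unique _ c1 c2).
Unshelve. all: by end_near. Qed.

(** The atom is at most the moment of order 1/2; at sigma = 2 this reads 2^(-c) <= 2^(-1). With c =
    0 every [G s] would be the Dirac mass at 1 and there would be nothing to condition on. *)
Lemma le1_laplace_limit : 1 <= c.
Proof.
have l12 : 1 <= 2 :> R by rewrite ler1n.
have := mass_at1_le _ _ hG hpsi 2 2^-1 l12; rewrite invr_gt0 ltr0n => /(_ isT).
rewrite mass_at1_powR// hpsi_half -ler_ln ?posrE ?powR_gt0// !ln_powR.
by rewrite ler_pM2r ?ln_gt0 ?ltr1n// lerN2.
Qed.

Lemma right_derivative_mass_at1 : right_derivative gamma 1 = - c.
Proof.
apply: cvg_lim => //.
have /cvg_at_right_shift := powR_cvg_right1 (- c).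
apply: cvg_trans; apply: near_eq_cvg; near=> h.
have h0 : 0 < h by near: h; exact: nbhs_right_gt.
rewrite !mass_at1_powR// ?lerDl ?ltW// powR1.
by rewrite (addrC 1 h) addrK.
Unshelve. all: by end_near. Qed.

Lemma moment_G_powR (s : R) (n : nat) : 1 <= s -> (0 < n)%N ->
  moment (G s) n = s `^ (- psi n%:R) - s `^ (- c).
Proof. by move=> s1 n0; rewrite (moment_G _ _ hG hpsi)// mass_at1_powR. Qed.

Lemma powR_lt1 (s : R) : 1 < s -> s `^ (- c) < 1.
Proof.
move=> s1; have s0 : 0 < s by rewrite (lt_trans _ s1).
rewrite -ltr_ln ?posrE ?powR_gt0// ln_powR ln1 mulNr oppr_lt0 mulr_gt0 ?ln_gt0//.
exact: lt_le_trans le1_laplace_limit.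
Qed.

Lemma fine_measure_below1 (s : R) : 1 < s ->
  (0 < G s I01)%E /\ fine (G s I01) = 1 - s `^ (- c).
Proof.
move=> s1; rewrite (measure_below1 _ hG) ?ltW// mass_at1_powR ?ltW//.
by rewrite lte_fin subr_gt0 powR_lt1.
Qed.

Lemma Rintegral_conditioned_below1 (s : R) (f : R -> R) (M : R) : 1 < s ->
  measurable_fun (I01 : set R) f -> (forall r : R, 0 <= r < 1 -> `|f r| <= M) ->
  \int[conditioned_below1 G s]_(r in `[0, 1[) f r =
  (1 - s `^ (- c))^-1 * \int[G s]_(r in `[0, 1[) f r.
Proof.
move=> s1 mf fM; have [G0 Gfin] := fine_measure_below1 _ s1.
rewrite /conditioned_below1 (@Rintegral_mnormalize_mrestr _ _ _ (G s) _ _ _ _ _ _ f M)//.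
- by rewrite setIid Gfin.
- exact: probability_lty.
Qed.

(** After division by s - 1, numerator and denominator are differences of right difference quotients
    of powers at 1. Order 0 stands apart, since the Laplace exponent determines [psi] at positive
    arguments only. *)
Lemma moment_conditioned_below1 (n : nat) :
  moment (conditioned_below1 G s) n @[s --> 1^'+] -->
  if n == 0%N then 1 else 1 - psi n%:R / c.
Proof.
have c0 : 0 < c by exact: lt_le_trans le1_laplace_limit.
have mE s k : 1 < s -> moment (conditioned_below1 G s) k =
    (1 - s `^ (- c))^-1 * moment (G s) k.
  move=> s1; rewrite /moment (@Rintegral_conditioned_below1 _ _ 1)//.
  by move=> r /andP[r0 r1]; rewrite ger0_norm ?exprn_ge0// exprn_ile1// ltW.
have [->|n0] := eqVneq n 0%N.
  apply: cvg_near_cst; near=> s.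
  have s1 : 1 < s by near: s; exact: nbhs_right_gt.
  rewrite mE// /moment; under eq_Rintegral do rewrite expr0.
  rewrite Rintegral_cst// mul1r (fine_measure_below1 _ s1).2 mulVf//.
  by rewrite gt_eqF// subr_gt0 powR_lt1.
have : ((s - 1)^-1 * (s `^ (- psi n%:R) - 1) - (s - 1)^-1 * (s `^ (- c) - 1)) /
    (- ((s - 1)^-1 * (s `^ (- c) - 1))) @[s --> 1^'+] --> (- psi n%:R - (- c)) / (- - c).
  apply: cvgM.
    by apply: cvgB; exact: powR_cvg_right1.
  by apply: cvgV; [rewrite opprK gt_eqF|apply: cvgN; exact: powR_cvg_right1].
have -> : (- psi n%:R - - c) / - - c = 1 - psi n%:R / c by field; rewrite gt_eqF.
apply: cvg_trans; apply: near_eq_cvg; near=> s.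
have s1 : 1 < s by near: s; exact: nbhs_right_gt.
rewrite mE// moment_G_powR ?lt0n// ?ltW//; field.
by have h := powR_lt1 _ s1; rewrite !subr_eq0 (gt_eqF h) (gt_eqF s1) (lt_eqF h).
Unshelve. all: by end_near. Qed.

End laplace_limit.

(** * The limit law as an image of the normalised Levy measure *)

Section jump_law.
Context {R : realType}.
Variable nu : {measure set R -> \bar R}.
Let m0y : measurable (`[0%R, +oo[%classic : set R). Proof. by []. Qed.
Local Notation I01 := `[0%R, 1%R[%classic.

(* The limit law [Gbar]; the Dirac mass is used only if [nu] has mass 0 or +oo. *)
Definition jump_law : probability R R :=
  distribution (mnormalize (mrestr nu m0y) (\d_(0 : R))) (@expR_opp R).

Hypotheses (nu0 : nu [set 0] = 0%E) (nupos : (0 < nu `[0%R, +oo[)%E)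
  (nufin : (nu `[0%R, +oo[ < +oo)%E).

Let preimage_expR_opp : @expR_opp R @^-1` I01 = `]0%R, +oo[%classic.
Proof.
apply/seteqP; split => x; rewrite /= !in_itv/= andbT /expR_opp expR_ge0/=.
  by rewrite -[X in _ < X]expR0 ltr_expR oppr_lt0.
by move=> x0; rewrite -[X in _ < X]expR0 ltr_expR oppr_lt0.
Qed.

Let itv_oyE : `]0%R, +oo[ `&` `[0%R, +oo[ = `]0%R, +oo[%classic :> set R.
Proof.
by apply/setIidl => x; rewrite /= !in_itv/= !andbT; exact: ltW.
Qed.

Let nu_oy : nu `]0%R, +oo[ = nu `[0%R, +oo[.
Proof.
have -> : `[0%R, +oo[%classic = [set 0] `|` `]0, +oo[ :> set R.
  apply/seteqP; split => x; rewrite /= !in_itv/= !andbT.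
    by rewrite le_eqVlt => /predU1P[<-|]; [left|right].
  by case=> [->|/ltW].
rewrite measureU//; first by rewrite [X in _ = (X + _)%E]nu0 add0e.
by apply/seteqP; split => // x [/= ->]; rewrite in_itv/= ltxx.
Qed.

Let c := fine (nu `[0%R, +oo[).

Let c0 : 0 < c.
Proof. by rewrite fine_gt0// nupos. Qed.

(** exp(-x) < 1 exactly when x > 0, and [nu] does not charge 0, so no mass lands on the point 1. *)
Lemma jump_law_below1 : jump_law I01 = 1%E.
Proof.
transitivity (mnormalize (mrestr nu m0y) \d_(0 : R) (@expR_opp R @^-1` I01)) => //.
rewrite preimage_expR_opp; transitivity (nu (`]0%R, +oo[ `&` `[0%R, +oo[) * (c^-1)%:E)%E.
  exact: mnormalize_mrestrE.
rewrite itv_oyE nu_oy -[nu _]fineK ?ge0_fin_numE// -EFinM divff// gt_eqF//.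
Qed.

Lemma moment_jump_law (n : nat) : moment jump_law n =
  1 - (\int[nu]_(x in `[0, +oo[) (1 - expR (- (n%:R * x)))) / c.
Proof.
rewrite /moment /Rintegral /jump_law ge0_integral_pushforward//; last 2 first.
- by apply/measurable_EFinP; exact: measurable_funX.
- by move=> r; rewrite inE/= in_itv/= lee_fin => /andP[r0 _]; rewrite exprn_ge0.
rewrite [X in (\int[_]_(_ in X) _)%E](_ : _ = `]0%R, +oo[%classic); last exact: preimage_expR_opp.
rewrite -/(Rintegral _ _ (fun x => expR_opp x ^+ n)).
have mf : measurable_fun setT (fun x : R => expR_opp x ^+ n).
  by apply: measurable_funX; exact: expR_opp_measurable.
have f1 (x : R) : (`]0%R, +oo[%classic : set R) x -> `|expR_opp x ^+ n| <= 1.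
  rewrite /= in_itv/= andbT => x0; rewrite ger0_norm ?exprn_ge0 ?expR_ge0//.
  by rewrite exprn_ile1 ?expR_ge0// -expR0 ler_expR oppr_le0 ltW.
rewrite (@Rintegral_mnormalize_mrestr _ _ _ nu _ _ _ _ _ _ _ 1)//; last exact: measurable_funTS.
rewrite setIC itv_oyE.
have nuoy : (nu `]0%R, +oo[ < +oo)%E by rewrite nu_oy.
(* Written as 1 minus the integrand of psi(n); both parts are integrable because [nu] is finite. *)
have -> : \int[nu]_(x in `]0, +oo[) (expR_opp x ^+ n) =
    \int[nu]_(x in `]0, +oo[) (1 - (1 - expR (- (n%:R * x)))).
  by apply: eq_Rintegral => x _; rewrite subKr /expR_opp -expRM_natl mulrN.
have me : measurable_fun setT (fun x : R => 1 - expR (- (n%:R * x))).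
  apply: measurable_funB => //; apply: measurableT_comp => //.
  by apply: measurableT_comp => //; exact: measurable_funM.
rewrite RintegralB//; last 2 first.
- by apply: (@bounded_integrable _ _ _ _ _ _ 1) => // x _; rewrite normr1.
- apply: (@bounded_integrable _ _ _ _ _ _ 1) => //; first exact: measurable_funTS.
  move=> x; rewrite /= in_itv/= andbT => x0; rewrite ger0_norm ?subr_ge0.
    by rewrite gerBl expR_ge0.
  by rewrite -expR0 ler_expR oppr_le0 mulr_ge0// ltW.
rewrite Rintegral_cst// mul1r nu_oy.
have -> : \int[nu]_(x in `]0, +oo[) (1 - expR (- (n%:R * x))) =
    \int[nu]_(x in `[0, +oo[) (1 - expR (- (n%:R * x))).
  rewrite Rintegral_mkcond [in RHS]Rintegral_mkcond; apply: eq_Rintegral => x _.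
  rewrite !patchE !mem_setE !in_itv/= !andbT.
  by case: (ltgtP 0 x) => // <-; rewrite mulr0 oppr0 expR0 subrr.
set I := \int[nu]_(x in _) _; transitivity (c^-1 * (c - I)) => //.
by rewrite mulrBr mulVf ?gt_eqF// mulrC.
Qed.

End jump_law.

(** * The generator *)

Section calculus.
Context {R : realType}.

(** The mean value theorem for an increment of either sign. Measuring [xi] from [x] allows a second
    application, to [df] between [x] and [x + xi]. *)
Lemma MVT_point (f df : R -> R) : (forall x : R, is_derive x 1 f (df x)) ->
  forall x b, exists2 xi, `|xi| <= `|b| & f (x + b) - f x = df (x + xi) * b.
Proof.
move=> fdf x b.
have cf y : {for y, continuous f}.
  by apply: differentiable_continuous; apply/derivable1_diffP; exact: ex_derive.
have [b0|b0|->] := ltgtP b 0; last by exists 0; rewrite ?normr0// addr0 subrr mulr0.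
- have xb : x + b < x by rewrite gtrDl.
  have [y] := @MVT R f df (x + b) x xb (fun y _ => fdf y) (continuous_subspaceT cf).
  rewrite in_itv/= => /andP[y1 y2] E; exists (y - x).
    by rewrite !ltr0_norm// ?subr_lt0//; lra.
  by rewrite -opprB E subrKC; ring.
- have xb : x < x + b by rewrite ltrDl.
  have [y] := @MVT R f df x (x + b) xb (fun y _ => fdf y) (continuous_subspaceT cf).
  rewrite in_itv/= => /andP[y1 y2] E; exists (y - x).
    by rewrite !gtr0_norm// ?subr_gt0//; lra.
  by rewrite E subrKC; ring.
Qed.

Lemma is_derive_quotient (g : R -> R) (x dg : R) : is_derive x 1 g dg ->
  forall e, 0 < e -> exists2 r, 0 < r & forall h, `|h| < r -> h != 0 ->
    `|dg - h^-1 * (g (x + h) - g x)| <= e.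
Proof.
move=> [dx <-] e e0; have /cvgrPdist_le /(_ _ e0) /nbhs_ballP[r r0 hr] := dx.
exists r; first exact: r0.
move=> h hlt h0; have := hr h; rewrite /ball/= sub0r normrN => /(_ hlt h0).
by rewrite /GRing.scale/= mulr1 (addrC h).
Qed.

Lemma vanishing_bounded (f : R -> R) : continuous f -> vanishes_at_infinity f ->
  exists2 M, 0 <= M & forall x, `|f x| <= M.
Proof.
move=> cf [/cvgrPdist_le /(_ 1 ltr01) [A [_ hA]] /cvgrPdist_le /(_ 1 ltr01) [B [_ hB]]].
have [M [Mr HM]] := compact_bounded (continuous_compact
  (continuous_subspaceT cf) (@segment_compact R B A)).
exists (`|M| + 1); first by rewrite addr_ge0.
move=> x; have [xA|Ax] := leP x A; last first.
  by have := hA _ Ax; rewrite sub0r normrN => /le_trans; apply; rewrite lerDr.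
have [Bx|xB] := leP B x; last first.
  by have := hB _ xB; rewrite sub0r normrN => /le_trans; apply; rewrite lerDr.
apply: (HM (`|M| + 1)); first by rewrite (le_lt_trans (ler_norm M))// ltrDl.
by exists x => //=; rewrite in_itv/= Bx.
Qed.

Section C20.
Variable f : R -> R.
Hypothesis hf : C20 f.
Local Notation f' := (f^`())%classic.
Local Notation f'' := (f^`(2))%classic.

Lemma C20_is_derive (x : R) : is_derive x 1 f (f' x).
Proof.
have [[d _ _] _] := hf; have E : 'D_1 f x = f' x by rewrite -derive1E.
exact: (DeriveDef (d x) E).
Qed.

Lemma C20_is_derive2 (x : R) : is_derive x 1 f' (f'' x).
Proof.
have [[_ d _] _] := hf; have E : 'D_1 f' x = f'' x by rewrite -derive1E.
exact: (DeriveDef (d x) E).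
Qed.

Lemma C20_continuous : continuous f.
Proof.
by move=> x; apply: differentiable_continuous; apply/derivable1_diffP; have [[]] := hf.
Qed.

Lemma C20_bounded : exists2 M, 0 <= M & forall x, `|f x| <= M.
Proof. by apply: vanishing_bounded; [exact: C20_continuous|have [_ []] := hf]. Qed.

Lemma C20_lipschitz : exists2 L, 0 <= L & forall x y, `|f x - f y| <= L * `|x - y|.
Proof.
have [||L L0 hL] := @vanishing_bounded f'.
- move=> x; apply: differentiable_continuous; apply/derivable1_diffP.
  by have [[]] := hf.
- by have [_ []] := hf.
exists L => // x y; have [xi _] := MVT_point _ _ C20_is_derive y (x - y).
by rewrite subrKC => ->; rewrite normrM ler_wpM2r.
Qed.

(** The mean value theorem twice. This gives a bound of |f''| as [K] rather than half of it, which
    is enough for domination. *)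
Lemma C20_taylor_bound : exists2 K, 0 <= K &
  forall x b, `|f (x + b) - f x - f' x * b| <= K * b ^+ 2.
Proof.
have [||K K0 hK] := @vanishing_bounded f''.
- by have [[]] := hf.
- by have [_ []] := hf.
exists K => // x b; have [xi xib ->] := MVT_point _ _ C20_is_derive x b.
have [eta _ E] := MVT_point _ _ C20_is_derive2 x xi.
rewrite -mulrBl E !normrM -mulrA -real_normK ?num_real// expr2.
by rewrite ler_pM ?mulr_ge0// ler_wpM2r.
Qed.

(** Once the linear and quadratic terms are subtracted, the derivative of [g] at [u] is f'(u) -
    f'(x) - f''(x) (u - x), which is o(u - x) by differentiability of f' at x. One application of
    the mean value theorem finishes. *)
Lemma C20_taylor (x e : R) : 0 < e -> \forall b \near (0 : R),
  `|f (x + b) - f x - f' x * b - 2^-1 * f'' x * b ^+ 2| <= e * b ^+ 2.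
Proof.
move=> e0; have [r r0 hr] := is_derive_quotient _ _ _ (C20_is_derive2 x) _ e0.
apply/nbhs_ballP; exists r; first exact: r0.
move=> b; rewrite /ball/= sub0r normrN => br.
pose g (u : R) := f u - f' x * (u - x) - 2^-1 * f'' x * (u - x) ^+ 2.
have dg (u : R) : is_derive u 1 g (f' u - f' x - f'' x * (u - x)).
  have du := C20_is_derive u; apply: is_derive_eq.
  by rewrite /GRing.scale/=; lra.
have [xi xib gE] := MVT_point _ _ dg x b.
have -> : f (x + b) - f x - f' x * b - 2^-1 * f'' x * b ^+ 2 = g (x + b) - g x.
  by rewrite /g; ring.
rewrite gE.
rewrite normrM -(real_normK (num_real b)) expr2 mulrA ler_wpM2r//.
rewrite (addrAC x xi) subrr add0r.
apply: (@le_trans _ _ (e * `|xi|)); last by rewrite ler_wpM2l// ltW.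
have [->|xi0] := eqVneq xi 0; first by rewrite addr0 subrr mulr0 subrr normr0 mulr0.
have {hr} h := hr xi (le_lt_trans xib br) xi0.
have -> : f' (x + xi) - f' x - f'' x * xi = - (f'' x - xi^-1 * (f' (x + xi) - f' x)) * xi.
  by field.
by rewrite normrM normrN ler_wpM2r.
Qed.

End C20.
End calculus.

(** * The generator at time 0 *)

Section generator0.
Context {R : realType}.
Variable G : R -> probability R R.
Local Notation N := (@normal_prob R 0 1).

(** The first-order term f'(x) sqrt(t) Z has mean 0 and may be subtracted inside the mean. What
    remains, divided by t, is dominated by K Z^2 and tends to f''(x) Z^2 / 2, whose mean is f''(x) /
    2. *)
Lemma gauss_mean_second_order (f : R -> R) (x : R) : C20 f ->
  t^-1 * (gauss_mean f x (Num.sqrt t) - f x) @[t --> 0^'+] -->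
  2^-1 * f^`(2)%classic x.
Proof.
move=> hf; have [M M0 fM] := C20_bounded _ hf; have cf := C20_continuous _ hf.
have [K K0 hK] := C20_taylor_bound _ hf.
set f1 := f^`()%classic x; set f2 := f^`(2)%classic x.
apply/cvg_at_rightP => u [u0 cu].
pose F (n : nat) (z : R) :=
  (u n)^-1 * (f (x + Num.sqrt (u n) * z) - f x - f1 * (Num.sqrt (u n) * z)).
have iN n : N.-integrable setT (EFin \o (fun z => f (x + Num.sqrt (u n) * z))).
  exact: (integrable_gauss_mean _ _ cf fM).
have FE n : (u n)^-1 * (gauss_mean f x (Num.sqrt (u n)) - f x) = \int[N]_z F n z.
  have il : N.-integrable setT (EFin \o (fun z => f1 * Num.sqrt (u n) * z)).
    exact: (integrableZl measurableT (f1 * Num.sqrt (u n)) integrable_normal_id).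
  have i2 : N.-integrable setT (EFin \o (fun z => f (x + Num.sqrt (u n) * z) - f x)).
    exact: (integrableB measurableT (iN n) (integrable_normal_cst (f x))).
  have i3 : N.-integrable setT (EFin \o (fun z =>
      f (x + Num.sqrt (u n) * z) - f x - f1 * Num.sqrt (u n) * z)).
    exact: (integrableB measurableT i2 il).
  transitivity (\int[N]_z ((u n)^-1 *
      (f (x + Num.sqrt (u n) * z) - f x - f1 * Num.sqrt (u n) * z))); last first.
    by apply: eq_Rintegral => z _; rewrite /F mulrA.
  rewrite (RintegralZl _ measurableT i3) (RintegralB measurableT i2 il)
    (RintegralB measurableT (iN n) (integrable_normal_cst (f x))).
  rewrite (RintegralZl _ measurableT integrable_normal_id) Rintegral_normal_id mulr0 subr0.
  by rewrite Rintegral_normal_cst.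
rewrite (_ : (fun n => _) = (fun n => \int[N]_z F n z)); last by apply/funext.
have -> : 2^-1 * f2 = \int[N]_z (2^-1 * f2 * z ^+ 2).
  by rewrite (RintegralZl _ measurableT integrable_normal_sqr) Rintegral_normal_sqr mulr1.
have usqr n z : (Num.sqrt (u n) * z) ^+ 2 = u n * z ^+ 2.
  by rewrite exprMn sqr_sqrtr// ltW.
have [//|||||_] := @cvg_Rintegral _ _ _ N setT F (fun z => 2^-1 * f2 * z ^+ 2)
  (fun z => K * z ^+ 2).
- move=> n; apply: continuous_measurable_fun => z; rewrite /F.
  apply: cvgMl_tmp; apply: cvgB; last first.
    by apply: cvgMl_tmp; apply: cvgMl_tmp; exact: cvg_id.
  apply: cvgB; last exact: cvg_cst.
  apply: continuous_comp; last exact: cf.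
  by apply: cvgD; [exact: cvg_cst|apply: cvgMl_tmp; exact: cvg_id].
- move=> z _; apply/cvgrPdist_le => e e0.
  (* The Taylor remainder carries a factor z^2, absorbed by this tolerance; the added 1 covers z =
     0. *)
  have e1 : 0 < e / (z ^+ 2 + 1) by rewrite divr_gt0// ltr_wpDl// sqr_ge0.
  have cb : Num.sqrt (u n) * z @[n --> \oo] --> (0 : R).
    rewrite -(mul0r z) -(@sqrtr0 R); apply: cvgMr_tmp.
    exact: (cvg_comp u Num.sqrt cu (@sqrt_continuous R 0)).
  have cbt := cb _ (C20_taylor _ hf x _ e1); near=> n.
  have h : `|f (x + Num.sqrt (u n) * z) - f x - f1 * (Num.sqrt (u n) * z)
      - 2^-1 * f2 * (u n * z ^+ 2)| <= e / (z ^+ 2 + 1) * (u n * z ^+ 2).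
    by rewrite -usqr; near: n; exact: cbt.
  have -> : 2^-1 * f2 * z ^+ 2 - F n z = - ((u n)^-1 *
     (f (x + Num.sqrt (u n) * z) - f x - f1 * (Num.sqrt (u n) * z)
       - 2^-1 * f2 * (u n * z ^+ 2))).
    by rewrite /F; field; rewrite gt_eqF.
  rewrite normrN normrM gtr0_norm ?invr_gt0// mulrC ler_pdivrMr//.
  apply: le_trans h _; rewrite [u n * _]mulrC mulrA ler_wpM2r ?(ltW (u0 n))//.
  rewrite -mulrA ler_piMr ?(ltW e0)// mulrC ler_pdivrMr ?mul1r ?lerDl//.
  by rewrite ltr_wpDl// sqr_ge0.
- exact: (integrableZl measurableT K integrable_normal_sqr).
- move=> n z _; rewrite /F normrM gtr0_norm ?invr_gt0// mulrC ler_pdivrMr//.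
  by apply: le_trans (hK _ _) _; rewrite usqr mulrA mulrAC.
by [].
Unshelve. all: by end_near. Qed.

Lemma generator_at0 (f : R -> R) (x : R) : C20 f ->
  has_generator G 0 f x (2^-1 * f^`(2)%classic x).
Proof.
move=> hf; have [M M0 fM] := C20_bounded _ hf.
apply: cvg_trans (gauss_mean_second_order f x hf); apply: near_eq_cvg; near=> t.
rewrite subr0 (Rintegral_transition0 _ _ _ _ M)//; first exact: C20_continuous.
Unshelve. all: by end_near. Qed.

End generator0.

(** * The generator at positive times *)

Section generator.
Context {R : realType}.
Local Notation I01 := (`[0%R, 1%R[%classic : set R).
Notation mu := (@lebesgue_measure R).

Section time_change.
Variable s : R.
Hypothesis s0 : 0 < s.
Local Notation sigma t := (Num.sqrt (t / s)).

Lemma sigma_gt1 (t : R) : s < t -> 1 < sigma t.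
Proof.
by move=> st; rewrite -[ltLHS]sqrtr1 ltr_sqrt ?divr_gt0 ?(lt_trans s0 st)// ltr_pdivlMr// mul1r.
Qed.

Lemma cvg_sigma : sigma t @[t --> s^'+] --> (1 : R).
Proof.
have h : t / s @[t --> s^'+] --> (1 : R).
  rewrite -(@divff _ s) ?gt_eqF//; apply: cvgMr_tmp.
  exact: cvg_at_right_filter cvg_id.
by have := cvg_comp _ _ h (@sqrt_continuous R 1); rewrite sqrtr1.
Qed.

Lemma cvg_sigma_right : sigma t @[t --> s^'+] --> 1^'+.
Proof.
move=> A [r /= r0 hr]; have /cvgrPdist_lt /(_ r r0) := cvg_sigma.
move=> h; suff : \forall t \near s^'+, A (sigma t) by [].
near=> t; apply: hr; last first.
  by apply: sigma_gt1; near: t; exact: nbhs_right_gt.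
by near: t; exact: h.
Unshelve. all: by end_near. Qed.

(** Since t - s = s (sigma + 1) (sigma - 1), the quotient is exactly 1 / (s (sigma + 1)). *)
Lemma sigma_quotient : (t - s)^-1 * (sigma t - 1) @[t --> s^'+] --> (2 * s)^-1.
Proof.
have : (s * (sigma t + 1))^-1 @[t --> s^'+] --> (s * (1 + 1))^-1.
  apply: cvgV; first by rewrite gt_eqF// mulr_gt0// addr_gt0.
  by apply: cvgMl_tmp; apply: cvgD; [exact: cvg_sigma|exact: cvg_cst].
rewrite (mulrC s (1 + 1)); apply: cvg_trans; apply: near_eq_cvg; near=> t.
have st : s < t by near: t; exact: nbhs_right_gt.
have h1 := sigma_gt1 t st.
have h2 : sigma t ^+ 2 = t / s by rewrite sqr_sqrtr// divr_ge0// ltW// (lt_trans s0 st).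
have tE : t = s * sigma t ^+ 2 by rewrite h2; field; rewrite gt_eqF.
have -> : t - s = s * (sigma t + 1) * (sigma t - 1) by rewrite {1}tE; ring.
by field; rewrite !gt_eqF//; lra.
Unshelve. all: by end_near. Qed.

(** The chain rule for the time change t -> sigma(t), and the origin of every factor 1 / (2 s) in
    the generator. *)
Lemma cvg_sigma_quotient (g : R -> R) (l : R) :
  (r - 1)^-1 * (g r - g 1) @[r --> 1^'+] --> l ->
  (t - s)^-1 * (g (sigma t) - g 1) @[t --> s^'+] --> l / (2 * s).
Proof.
move=> gl; have h := cvg_comp _ _ cvg_sigma_right gl.
apply: cvg_trans (cvgM h sigma_quotient); apply: near_eq_cvg; near=> t => /=.
have st : s < t by near: t; exact: nbhs_right_gt.
have h1 := sigma_gt1 t st.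
by field; rewrite !subr_eq0 !gt_eqF.
Unshelve. all: by end_near. Qed.

End time_change.

Section jump.
Variables (G : R -> probability R R) (psi : R -> R) (c : R).
Hypothesis hG : log_convolution_semigroup G.
Hypothesis hpsi : has_laplace_exponent G psi.
Hypothesis hpsi_half : psi 2^-1 = 1.
Hypothesis hc : psi n%:R @[n --> \oo] --> c.
Variable Gbar : probability R R.
Hypothesis Gbar1 : Gbar I01 = 1%E.
Hypothesis weakG : weak_limit_below1 (conditioned_below1 G) Gbar.
Variables (f : R -> R) (x s : R).
Hypotheses (hf : C20 f) (s0 : 0 < s).
Local Notation sigma t := (Num.sqrt (t / s)).
Local Notation H t := (fun r => gauss_mean f (sigma t * Num.sqrt r * x) (Num.sqrt (t * (1 - r)))).

Let sigma_s : sigma s = 1. Proof. by rewrite divff ?sqrtr1// gt_eqF. Qed.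

Let continuous_path t : continuous (fun r : R => sigma t * Num.sqrt r * x).
Proof.
by move=> r; apply: cvgMr_tmp; apply: cvgMl_tmp; exact: sqrt_continuous.
Qed.

Lemma integrable_H (m : probability R R) t : m.-integrable I01 (EFin \o H t).
Proof.
have [M M0 fM] := C20_bounded _ hf; have [L L0 fL] := C20_lipschitz _ hf.
exact: (integrable_gauss_mean_path _ _ _ (C20_continuous _ hf) fM L0 fL _ _ _
  (continuous_path t) (continuous_sqrt_onem t)).
Qed.

(** [H t] is replaced by [H s] at a cost that is uniform over r in [0, 1) and vanishes as t tends to
    s; the weak limit is then applied to the fixed bounded continuous function [H s]. *)
Lemma cvg_jump_part :
  \int[conditioned_below1 G (sigma t)]_(r in I01) H t r @[t --> s^'+] -->
  \int[Gbar]_(r in I01) H s r.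
Proof.
have [M M0 fM] := C20_bounded _ hf; have [L L0 fL] := C20_lipschitz _ hf.
have cf := C20_continuous _ hf.
have cHs : continuous (H s).
  exact: (continuous_gauss_mean _ _ _ M L cf fM L0 fL (continuous_path s)
    (continuous_sqrt_onem s)).
have c1 : \int[conditioned_below1 G (sigma t)]_(r in I01) H s r @[t --> s^'+] -->
    \int[Gbar]_(r in I01) H s r.
  have bHs : exists M' : R, forall r, 0 <= r < 1 -> `|H s r| <= M'.
    by exists M => r _; exact: (gauss_mean_le _ _ cf fM).
  exact: (cvg_comp (fun t => sigma t) (fun u => \int[conditioned_below1 G u]_(r in I01) H s r)
    (cvg_sigma_right _ s0) (weakG _ (continuous_subspaceT cHs) bHs)).
have c2 : L * (`|sigma t - 1| * `|x| + `|Num.sqrt t - Num.sqrt s|) @[t --> s^'+] --> (0 : R).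
  rewrite (_ : 0 = L * (`|1 - 1| * `|x| + `|Num.sqrt s - Num.sqrt s|)); last first.
    by rewrite !subrr normr0 mul0r addr0 mulr0.
  apply: cvgMl_tmp; apply: cvgD.
    by apply: cvgMr_tmp; apply: cvg_norm; apply: cvgB; [exact: cvg_sigma|exact: cvg_cst].
  apply: cvg_norm; apply: cvgB; last exact: cvg_cst.
  by apply: cvg_at_right_filter; exact: sqrt_continuous.
have c3 : \int[conditioned_below1 G (sigma t)]_(r in I01) H t r -
    \int[conditioned_below1 G (sigma t)]_(r in I01) H s r @[t --> s^'+] --> (0 : R).
  apply/cvgr0Pnorm_le => e e0; move/cvgr0Pnorm_le : c2 => /(_ e e0) c2'; near=> t.
  have st : s < t by near: t; exact: nbhs_right_gt.
  have t0 : 0 <= t by rewrite ltW// (lt_trans s0).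
  apply: (@le_trans _ _ (L * (`|sigma t - 1| * `|x| + `|Num.sqrt t - Num.sqrt s|))); last first.
    by rewrite (le_trans (ler_norm _))//; near: t.
  set m := conditioned_below1 G (sigma t).
  set B := L * _.
  have B0 : 0 <= B by rewrite mulr_ge0// addr_ge0// mulr_ge0.
  have iB : m.-integrable I01 (EFin \o cst B).
    by apply: (@integrable_itv01 _ _ _ `|B|).
  rewrite -(RintegralB (measurable_itv _) (integrable_H m t) (integrable_H m s))//.
  apply: (@le_trans _ _ (\int[m]_(r in I01) cst B r)).
    apply: (@Rintegral_bound _ _ _ m I01 (fun r => H t r - H s r)) => //.
      exact: (integrableB (measurable_itv _) (integrable_H m t) (integrable_H m s)).
    move=> r; rewrite /= in_itv/= => /andP[r0 r1].
    apply: (le_trans (gauss_mean_lipschitz _ _ cf fM _ _ _ _ _ L0 fL)).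
    rewrite ler_wpM2l// lerD//.
      rewrite sigma_s -mulrBl -mulrBl 2!normrM ler_wpM2r// ler_piMr//.
      by rewrite ger0_norm ?sqrtr_ge0// -[leRHS]sqrtr1 ler_wsqrtr// ltW.
    rewrite !sqrtrM// ?(ltW s0)// -mulrBl normrM ler_piMr//.
    by rewrite ger0_norm ?sqrtr_ge0// -[leRHS]sqrtr1 ler_wsqrtr// gerBl.
  rewrite Rintegral_cst// ler_piMr//.
  rewrite -lee_fin fineK ?fin_num_measure//; exact: probability_le1.
rewrite -[X in _ --> X]add0r.
rewrite (_ : (fun t => _) = (fun t =>
    \int[conditioned_below1 G (sigma t)]_(r in I01) H t r -
    \int[conditioned_below1 G (sigma t)]_(r in I01) H s r +
    \int[conditioned_below1 G (sigma t)]_(r in I01) H s r)); last first.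
  by apply/funext => t; rewrite subrK.
exact: (cvgD c3 c1).
Unshelve. all: by end_near. Qed.

(** The mixture formula for z |-> f(x + z) - f(x). Translation by x turns the mean sqrt(r) x into
    (sqrt(r) - 1) x, and the full mass of [Gbar] on [0, 1) brings [f x] under the integral. *)
Lemma jump_partE : \int[Gbar]_(r in I01) H s r - f x =
  \int[mu]_z ((f (x + z) - f x) *
    \int[Gbar]_(r in I01) gauss_pdf ((Num.sqrt r - 1) * x) (s * (1 - r)) z).
Proof.
have [M M0 fM] := C20_bounded _ hf; have [L L0 fL] := C20_lipschitz _ hf.
have cf := C20_continuous _ hf.
pose g z := f (x + z) - f x.
have cfx : continuous (fun z => f (x + z)).
  move=> z; apply: continuous_comp; last exact: cf.
  by apply: cvgD; [exact: cvg_cst|exact: cvg_id].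
have cg : continuous g by move=> z; apply: cvgB; [exact: cfx|exact: cvg_cst].
have gM z : `|g z| <= M + M by rewrite (le_trans (ler_normB _ _))// lerD.
have gL y z : `|g y - g z| <= L * `|y - z|.
  rewrite /g opprB addrA subrK (le_trans (fL _ _))//.
  by rewrite (_ : x + y - (x + z) = y - z)//; ring.
have ca : continuous (fun r : R => (Num.sqrt r - 1) * x).
  by move=> r; apply: cvgMr_tmp; apply: cvgB; [exact: sqrt_continuous|exact: cvg_cst].
rewrite (Rintegral_mixture Gbar _ s ca s0 g _ L cg gM L0 gL).
have -> : \int[Gbar]_(r in I01) gauss_mean g ((Num.sqrt r - 1) * x) (Num.sqrt (s * (1 - r))) =
    \int[Gbar]_(r in I01) (H s r - f x).
  apply: eq_Rintegral => r _; rewrite sigma_s mul1r.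
  rewrite (gauss_meanD (fun z => f (x + z)) M cfx (fun z => fM (x + z))).
  congr (_ - _); rewrite /gauss_mean; apply: eq_Rintegral => z _.
  by congr f; ring.
have ic : Gbar.-integrable I01 (EFin \o cst (f x)).
  by apply: (@integrable_itv01 _ _ _ `|f x|).
rewrite (RintegralB (measurable_itv _) (integrable_H Gbar s) ic) Rintegral_cst//.
have -> : fine (Gbar I01) = 1 by rewrite Gbar1.
by rewrite mulr1.
Qed.

Lemma generator_pos : has_generator G s f x
  (x / (2 * s) * f^`()%classic x + - right_derivative (mass_at1 G) 1 / (2 * s) *
    \int[mu]_z ((f (x + z) - f x) *
      \int[Gbar]_(r in I01) gauss_pdf ((Num.sqrt r - 1) * x) (s * (1 - r)) z)).
Proof.
have [M M0 fM] := C20_bounded _ hf; have [L L0 fL] := C20_lipschitz _ hf.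
have cf := C20_continuous _ hf.
rewrite -jump_partE (right_derivative_mass_at1 G psi hG hpsi c hc) opprK.
have cgam : sigma t `^ (- c) @[t --> s^'+] --> (1 : R).
  have d1 := @is_derive1_powR R (- c) 1 ltr01.
  have cp : {for (1 : R), continuous (fun u : R => u `^ (- c))}.
    by apply: differentiable_continuous; apply/derivable1_diffP; exact: ex_derive.
  have := cvg_comp (fun t => sigma t) (fun u => u `^ (- c)) (cvg_sigma _ s0) cp.
  by rewrite /= powR1.
have cdrift : (t - s)^-1 * (f (sigma t * x) - f x) @[t --> s^'+] -->
    x * f^`()%classic x / (2 * s).
  (* The drift is the derivative of the dilation u |-> f(u x) at u = 1, followed by the time
     change. *)
  have d1 : is_derive (1 : R) 1 (fun u : R => f (u * x)) (x * f^`()%classic x).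
    have dx : is_derive (1 : R) 1 (fun u : R => u * x) x.
      by apply: is_derive_eq; rewrite /GRing.scale/=; ring.
    have df := C20_is_derive _ hf (1 * x); rewrite {2}mul1r in df.
    by rewrite mulrC; exact: is_derive1_comp.
  have := cvg_sigma_quotient _ s0 (fun u => f (u * x)) _ (is_derive_cvg_right _ _ _ d1).
  by rewrite mul1r.
have cmass : (t - s)^-1 * (1 - sigma t `^ (- c)) @[t --> s^'+] --> c / (2 * s).
  have hq : (r - 1)^-1 * (r `^ (- c) - 1 `^ (- c)) @[r --> (1 : R)^'+] --> - c.
    by rewrite powR1; exact: powR_cvg_right1.
  have hN := cvg_sigma_quotient _ s0 (fun u => u `^ (- c)) _ hq.
  rewrite (_ : c / (2 * s) = - (- c / (2 * s))); last by rewrite mulNr opprK.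
  rewrite (_ : (fun t => _) =
    (fun t => - ((t - s)^-1 * (sigma t `^ (- c) - 1 `^ (- c))))); last first.
    by apply/funext => t; rewrite powR1 -mulrN opprB.
  exact: (cvgN hN).
have cjump : \int[conditioned_below1 G (sigma t)]_(r in I01) H t r - f x @[t --> s^'+] -->
    \int[Gbar]_(r in I01) H s r - f x.
  by apply: cvgB; [exact: cvg_jump_part|exact: cvg_cst].
have lim : sigma t `^ (- c) * ((t - s)^-1 * (f (sigma t * x) - f x)) +
    (t - s)^-1 * (1 - sigma t `^ (- c)) *
      (\int[conditioned_below1 G (sigma t)]_(r in I01) H t r - f x) @[t --> s^'+] -->
    x / (2 * s) * f^`()%classic x + c / (2 * s) * (\int[Gbar]_(r in I01) H s r - f x).
  apply: cvgD; last exact: cvgM.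
  rewrite -[X in _ --> X]mul1r mulrAC; exact: cvgM.
rewrite /has_generator; apply: cvg_trans lim; apply: near_eq_cvg; near=> t => /=.
have st : s < t by near: t; exact: nbhs_right_gt.
have s1 := sigma_gt1 _ s0 t st.
have mE := mass_at1_powR G psi hG hpsi c hc (sigma t) (ltW s1).
rewrite (Rintegral_transition G _ _ _ s0 st _ f M L cf fM L0 fL); last first.
  by rewrite (measure_below1 _ hG)// ltW.
rewrite (Rintegral_conditioned_below1 G psi hG hpsi hpsi_half c hc _ _ M s1); last 2 first.
- by have /integrableP[/measurable_EFinP] := integrable_H Gbar t.
- by move=> r _; exact: (gauss_mean_le _ _ cf fM).
rewrite mE.
(* The mass of [0, 1) under [G (sigma t)] is nonzero, so it cancels against the normalisation of the
   conditioned law. *)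
have h1 := powR_lt1 G psi hG hpsi hpsi_half c hc _ s1.
by field; rewrite !subr_eq0 !gt_eqF.
Unshelve. all: by end_near. Qed.

End jump.
End generator.

Theorem proposition8 (R : realType) (G : R -> probability R R) (psi : R -> R)
    (hG : log_convolution_semigroup G)
    (hpsi : has_laplace_exponent G psi)
    (hpsi_half : psi 2^-1 = 1)
    (hgamma : forall sigma : R, 1 <= sigma -> 0 < mass_at1 G sigma)
    (hgamma' : right_derivable (mass_at1 G) 1)
    (hpsi0 : psi lambda @[lambda --> 0^'+] --> (0 : R))
    (d : measure_display) (Omega : measurableType d)
    (P : probability Omega R) (X : R -> {RV P >-> R})
    (hX : associated_process G X) :
  exists Gbar : probability R R,
    [/\ Gbar `[0, 1[ = 1%E,
        weak_limit_below1 (conditioned_below1 G) Gbar,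
        forall (f : R -> R) (x : R), C20 f ->
          has_generator G 0 f x (2^-1 * f^`(2)%classic x) &
        forall (f : R -> R) (x s : R), C20 f -> 0 < s ->
          has_generator G s f x
            (x / (2 * s) * f^`()%classic x
             + - right_derivative (mass_at1 G) 1 / (2 * s)
               * \int[lebesgue_measure]_z
                   ((f (x + z) - f x)
                    * \int[Gbar]_(r in `[0, 1[)
                        gauss_pdf ((Num.sqrt r - 1) * x) (s * (1 - r)) z))].
Proof.
have [nu [nu0 nufin psiE hc]] := laplace_exponent_finite G psi hG hpsi hgamma.
have c1 := le1_laplace_limit G psi hG hpsi hpsi_half _ hc.
have nupos : (0 < nu `[0%R, +oo[)%E.
  rewrite lt0e measure_ge0 andbT; apply/eqP => nu0y.
  by move: c1; rewrite nu0y/= ler10.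
have Gbar1 := jump_law_below1 nu nu0 nupos nufin.
have weakG : weak_limit_below1 (conditioned_below1 G) (jump_law nu).
  apply: moments_weak_limit => n.
  have := moment_conditioned_below1 G psi hG hpsi hpsi_half _ hc n.
  (* Order 0 amounts to the full mass of [jump_law nu] on [0, 1). *)
  have [->|n0] := eqVneq n 0%N.
    rewrite (_ : moment (jump_law nu) 0 = 1)//.
    rewrite /moment; under eq_Rintegral do rewrite expr0.
    rewrite Rintegral_cst// mul1r.
    by transitivity (fine (1%E : \bar R)) => //; congr fine.
  by rewrite (moment_jump_law nu nu0 nupos nufin) -psiE// lt0n.
exists (jump_law nu); split => //.
- by move=> f x; exact: generator_at0.
- move=> f x s hf s0.
  exact: (generator_pos G psi _ hG hpsi hpsi_half hc _ Gbar1 weakG).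
Qed.
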